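(* For every $x>0$ and $\mu>0$, the correlation coefficient $$\rho(x)=\frac{E(\tau(x)A(x))-E(\tau(x))E(A(x))}{\sqrt{\mathrm{Var}(\tau(x))\,\mathrm{Var}(A(x))}}$$ between $\tau(x)$ and $A(x)$ is $$\rho(x)=\left[\frac{3x^2\mu^2+12\mu x+12}{4x^2\mu^2+12\mu x+15}\right]^{1/2}>0.$$
   Context: Let $B_t$ be a standard one-dimensional Brownian motion ($B_0=0$). For $x>0$ and $\mu>0$ let $X(t)=x-\mu t+B_t$. The first-passage time below zero is $\tau(x)=\inf\{t>0: X(t)\le 0\}$ (finite almost surely), and the first-passage area is $A(x)=\int_0^{\tau(x)}X(t)\,dt$. *)

(* Defs.v *)
From HB Require Import structures.
From mathcomp Require Import all_boot all_order all_algebra.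
From mathcomp Require Import all_classical all_reals all_analysis.
Set Implicit Arguments.
Unset Strict Implicit.
Unset Printing Implicit Defensive.
Import Order.TTheory GRing.Theory Num.Theory.
Import numFieldNormedType.Exports.
Local Open Scope classical_set_scope.
Local Open Scope ring_scope.

Section Probability.
Context (d : measure_display) (T : measurableType d) (R : realType)
        (P : probability T R).

(* The product rule is required for the full family only; subfamilies are
   covered by taking A i = setT. *)
Definition mutually_independent (n : nat) (X : 'I_n -> T -> R) : Prop :=
  forall A : 'I_n -> set R, (forall i, measurable (A i)) ->
    P (\bigcap_(i in [set: 'I_n]) (X i @^-1` A i)) =
    (\prod_(i < n) P (X i @^-1` A i))%E.

(* Only the times t >= 0 matter; B t is unconstrained (but measurable) for
   t < 0. *)
Record standard_brownian_motion (B : R -> {RV P >-> R}) : Prop := {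
  sbm_start : {ae P, forall w, B 0 w = 0};
  sbm_independent_increments : forall (n : nat) (t : nat -> R),
    0 <= t 0%N -> (forall i, (i < n)%N -> t i <= t i.+1) ->
    mutually_independent (fun i : 'I_n => B (t i.+1) \- B (t i));
  (* normal_prob takes the standard deviation, not the variance.  The laws are
     compared on measurable sets only, since neither side is meaningful
     elsewhere. *)
  sbm_gaussian_increments : forall s t : R, 0 <= s -> s < t ->
    forall A : set R, measurable A ->
      P ((B t \- B s) @^-1` A) = normal_prob 0 (Num.sqrt (t - s)) A;
  sbm_continuous_paths :
    {ae P, forall w, {within `[0, +oo[, continuous (fun t : R => B t w)}}
}.

Definition drifted (B : R -> {RV P >-> R}) (mu x t : R) (w : T) : R :=
  x - mu * t + B t w.

(* +oo when the path never reaches ]-oo, 0]. *)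
Definition first_passage_time (X : R -> T -> R) (w : T) : \bar R :=
  ereal_inf [set t%:E | t in [set t : R | 0 < t /\ X t w <= 0]].

Definition first_passage_area (X : R -> T -> R) (w : T) : R :=
  \int[lebesgue_measure]_(t in [set t : R | 0 <= t /\
      (t%:E <= first_passage_time X w)%E]) X t w.

(* fine sends an infinite variance to 0 and the quotient is then 0, so a nonzero
   correlation entails finite nonzero variances. *)
Definition correlation (X Y : T -> R) : R :=
  (fine 'E_P[X \* Y]%E - fine 'E_P[X]%E * fine 'E_P[Y]%E) /
  Num.sqrt (fine 'V_P[X]%E * fine 'V_P[Y]%E).

End Probability.

(* Main.v *)
Require Import Defs.
From HB Require Import structures.
From mathcomp Require Import all_boot all_order all_algebra.
From mathcomp Require Import all_classical all_reals all_analysis.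
From mathcomp Require Import measurable_realfun ring lra.
Set Implicit Arguments.
Unset Strict Implicit.
Unset Printing Implicit Defensive.
Import Order.TTheory GRing.Theory Num.Theory.
Import numFieldNormedType.Exports.
Local Open Scope classical_set_scope.
Local Open Scope ring_scope.

(* Observe the path on the grid of mesh h = 2^-n, where X makes independent
   Gaussian steps, and let a be the left Riemann sum of X.  For suitable
   polynomials, with coefficients depending on h, in the time t, the position y
   and a, the process F_h(t, y, a) is an exact martingale; there is one with
   leading term c0 t + c1 a + c2 t^2 + c3 t a + c4 a^2 for every choice of the
   c_i.  Stop at the first grid time at which X <= eps: optional stopping gives
   E F_h = F_h(0, x, 0).  As n -> oo, and then eps -> 0, the stopped time,
   position and Riemann sum tend to tau, 0 and A by continuity of the path, so
   F_0(0, x, 0) is the expectation of c0 tau + c1 A + c2 tau^2 + c3 tau A +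
   c4 A^2.  Both limits are taken by dominated convergence: if K bounds
   |B_t| - mu t / 2 on the grids, then t, |y| and sqrt |a| are O(1 + K) up to
   the stopping time, and (1 + K)^4 is integrable because Doob's maximal
   inequality for exponential martingales gives K an exponential tail. *)

(** * Moments of the normal distribution *)

(** On a grid the martingale property is an algebraic identity in t, y and a, checked with the
    Gaussian moments up to order four, and optional stopping only happens at bounded indices. The
    price is the dependence of the coefficients on h, which is continuous and so harmless in the
    limit. Half of the drift is given up to the noise: |B_t| ever crosses K + mu t / 2 on the grids
    with probability at most 2 e^(-mu K), while the other half still brings X below zero by time 2
    (x + K) / mu. Time and height are then both linear in K, so the area is quadratic and its square
    accounts for the fourth power of 1 + K. Treating all quadratic polynomials in tau and A at once
    makes each variance a single expectation. The values tau and A are compared with measurable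
    functions only off a null set. *)

Section normal_moments.
Context {R : realType} (s : R) (s0 : 0 < s).
Local Notation mu := (@lebesgue_measure R).
Local Notation N := (normal_prob 0 s).

(** The density and the Radon-Nikodym derivative have the same integral over every measurable set,
    hence agree almost everywhere; the change of variables is then that of the derivative. *)
Lemma ge0_integral_normal_prob (f : R -> \bar R) :
  measurable_fun setT f -> (forall x, 0 <= f x)%E ->
  (\int[N]_x f x = \int[mu]_x (f x * (normal_pdf 0 s x)%:E))%E.
Proof.
move=> mf f0.
have dom := normal_prob_dominates 0 s.
rewrite -(Radon_Nikodym_SigmaFinite.change_of_variables dom)//.
have intRN := Radon_Nikodym_SigmaFinite.f_integrable dom.
apply: ae_eq_integral => //.
- by apply: emeasurable_funM => //; exact: (measurable_int mu).
- apply: emeasurable_funM => //; apply/measurable_EFinP.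
  exact: measurable_normal_pdf.
- apply: ae_eqe_mul2l; apply: integral_ae_eq => //.
  + by apply/measurable_EFinP; exact: measurable_normal_pdf.
  + by move=> E _ mE; rewrite -(Radon_Nikodym_SigmaFinite.f_integral dom).
Qed.

(** Completing the square: exponential tilting only shifts the mean of a Gaussian. *)
Lemma expR_normal_pdf (t v : R) :
  expR (t * v) * normal_pdf 0 s v =
  expR (t ^+ 2 * s ^+ 2 / 2) * normal_pdf (t * s ^+ 2) s v.
Proof.
rewrite !normal_pdfE ?gt_eqF// /normal_fun !(mulrCA _ (normal_peak s)) -!expRD.
congr (_ * expR _).
field.
by rewrite gt_eqF.
Qed.

Lemma normal_mgf (t : R) :
  (\int[N]_x (expR (t * x))%:E = (expR (t ^+ 2 * s ^+ 2 / 2))%:E)%E.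
Proof.
rewrite ge0_integral_normal_prob//; last first.
  apply/measurable_EFinP; apply: measurableT_comp => //.
under eq_integral do rewrite -EFinM expR_normal_pdf EFinM.
rewrite integralZl//; last exact: integrable_normal_pdf.
by rewrite integral_normal_pdf mule1.
Qed.

(** A single Taylor term is below [expR] at the absolute value, which is one of the two
    exponentials. *)
Lemma expr_le_cosh (k : nat) (v : R) :
  `|v| ^+ k.+1 <= k.+1`!%:R * (expR v + expR (- v)).
Proof.
have h := expR_ge1Dxn k (normr_ge0 v).
have h2 : `|v| ^+ k.+1 / k.+1`!%:R <= expR `|v|.
  by apply: le_trans h; rewrite lerDr.
rewrite -ler_pdivrMl ?ltr0n ?fact_gt0// mulrC.
apply: (le_trans h2); have [v0|v0] := leP 0 v.
  by rewrite ger0_norm// lerDl expR_ge0.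
by rewrite ltr0_norm// lerDr expR_ge0.
Qed.

Lemma normal_integrable_expr (k : nat) :
  N.-integrable setT (fun x => (x ^+ k)%:E).
Proof.
case: k => [|k]; first by apply: finite_measure_integrable_cst => //.
have intE t : N.-integrable setT (fun x => (expR (t * x))%:E).
  apply/integrableP; split.
    apply/measurable_EFinP; apply: measurableT_comp => //.
  under eq_integral do rewrite gee0_abs ?lee_fin ?expR_ge0//.
  by rewrite normal_mgf ltry.
apply: (@le_integrable _ _ _ N setT measurableT _
  (fun x => (k.+1`!%:R)%:E * ((expR (1 * x))%:E + (expR (-1 * x))%:E))%E) => //.
- by apply/measurable_EFinP; exact: measurable_funX.
- move=> v _; rewrite /= lee_fin normrX (le_trans (expr_le_cosh _ _))//.
  by rewrite mul1r mulN1r ler_norm.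
- by apply: integrableZl => //; apply: integrableD.
Qed.

(** The fundamental theorem of calculus on the intervals from -n to n leaves boundary values that
    vanish; the truncated integrals converge by domination by the absolute value of [f]. *)
Lemma integralT_derive0 (f F : R -> R) : continuous f ->
  (forall x : R, is_derive x 1 F (f x)) -> mu.-integrable setT (EFin \o f) ->
  (F n%:R @[n --> \oo] --> 0) -> (F (- n%:R) @[n --> \oo] --> 0) ->
  (\int[mu]_x (f x)%:E = 0)%E.
Proof.
move=> cf dF fi Fy FNy.
have cF : continuous F.
  move=> x; have := dF x => dFx; apply: differentiable_continuous.
  by apply/derivable1_diffP.
pose g n x : \bar R := ((EFin \o f) \_ `[- n%:R, n%:R]) x.
have mf : measurable_fun setT (EFin \o f) by exact: measurable_int fi.
have [_ _] : [/\ mu.-integrable setT (EFin \o f),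
  (\int[mu]_x `|g n x - (EFin \o f) x|)%E @[n --> \oo] --> 0%E &
  (\int[mu]_x g n x)%E @[n --> \oo] --> (\int[mu]_x (EFin \o f) x)%E].
  apply: (@dominated_convergence _ _ _ mu setT measurableT g (EFin \o f)
    (fun x => `|(EFin \o f) x|%E)) => //.
  - move=> n; apply/(measurable_restrictT _ _).1 => //.
    exact: measurable_funTS.
  - apply: aeW => x _; apply: cvg_near_cst; near=> n.
    rewrite /g patchE mem_set//= in_itv/= -ler_norml.
    near: n; exact: nbhs_infty_ger.
  - by apply: integrable_abse.
  - apply: aeW => x n _; rewrite /g patchE; case: ifPn => // _.
    by rewrite abse0.
have -> : (fun n => (\int[mu]_x g n x)%E) =
    (fun n : nat => (F n%:R - F (- n%:R))%:E).
  apply/funext => n.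
  rewrite /g -integral_mkcond.
  (* For [n = 0] the interval is a point, and the fundamental theorem asks for distinct end
     points. *)
  have [->|n0] := eqVneq n 0%N.
    rewrite oppr0 set_itv1 integral_set1 subrr//.
  rewrite (@continuous_FTC2 _ f F)//.
  - by rewrite gtrN// ltr0n lt0n.
  - by apply: continuous_subspaceT.
  - split.
    + by move=> x _; have := dF x => dFx; exact: ex_derive.
    + exact/cvg_at_right_filter/cF.
    + exact/cvg_at_left_filter/cF.
  - by move=> x _; have := dF x => dFx; rewrite derive1E derive_val.
move=> /cvg_unique; apply => //.
apply: cvg_EFin; first by apply: nearW.
by rewrite -[X in _ --> X](subr0 0); apply: cvgB.
Unshelve. all: by end_near. Qed.

End normal_moments.

Section normal_moment_recursion.
Context {R : realType} (s : R) (s0 : 0 < s).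
Local Notation mu := (@lebesgue_measure R).
Local Notation N := (normal_prob 0 s).

Lemma integral_normal_prob (f : R -> \bar R) : N.-integrable setT f ->
  mu.-integrable setT (fun x => f x * (normal_pdf 0 s x)%:E)%E /\
  (\int[N]_x f x = \int[mu]_x (f x * (normal_pdf 0 s x)%:E))%E.
Proof.
move=> fi; have mf : measurable_fun setT f by exact: measurable_int fi.
have pdfE x : 0 <= normal_pdf 0 s x by exact: normal_pdf_ge0.
have mfp : measurable_fun setT (fun x => f x * (normal_pdf 0 s x)%:E)%E.
  apply: emeasurable_funM => //; apply/measurable_EFinP.
  exact: measurable_normal_pdf.
split.
  apply/integrableP; split => //.
  under eq_integral do rewrite abseM (gee0_abs (x := _%:E)) ?lee_fin//.
  rewrite -ge0_integral_normal_prob//; last exact: measurableT_comp.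
  by have /integrableP[] := fi.
rewrite integralE [in RHS]integralE; congr (_ - _)%E.
  rewrite ge0_integral_normal_prob//; last exact: measurable_funepos.
  by apply: eq_integral => x _; rewrite !funeposE maxe_pMl ?lee_fin// mul0e ?mulNe.
rewrite ge0_integral_normal_prob//; last exact: measurable_funeneg.
by apply: eq_integral => x _; rewrite !funenegE maxe_pMl ?lee_fin// mul0e ?mulNe.
Qed.

Lemma is_derive_normal_pdf (x : R) :
  is_derive x 1 (normal_pdf 0 s) (- (x / s ^+ 2) * normal_pdf 0 s x).
Proof.
rewrite !normal_pdfE ?gt_eqF// /normal_fun.
rewrite (_ : (fun _ => _) =
    normal_peak s \*: (expR \o (- (s ^+ 2 *+ 2)^-1 \*: (@id R ^+ 2)))); last first.
  by apply/funext => y /=; congr (_ * expR _); rewrite subr0 mulNr mulrC -mulNr.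
apply: is_derive_eq.
rewrite /= /GRing.scale/= !expr1 subr0 !mulr1.
have -> : - x ^+ 2 / (s ^+ 2 *+ 2) = - (s ^+ 2 *+ 2)^-1 * x ^+ 2.
  by rewrite mulNr mulrC mulNr.
set e := expR _; field.
by rewrite gt_eqF.
Qed.

(** After [expr_le_cosh], each tilted density is bounded by its peak. Boundedness with exponent
    [k.+1] makes the expression with exponent [k] of order 1/n at the points n and -n, which
    disposes of the boundary terms below. *)
Lemma normal_expr_bounded (k : nat) : exists C, forall v : R,
  `|v ^+ k.+1 * normal_pdf 0 s v| <= C.
Proof.
exists (k.+1`!%:R * (expR (s ^+ 2 / 2) * normal_peak s *+ 2)) => v.
rewrite normrM normrX (ger0_norm (normal_pdf_ge0 _ _ _)).
apply: (@le_trans _ _ (k.+1`!%:R * (expR v + expR (- v)) * normal_pdf 0 s v)).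
  by rewrite ler_wpM2r ?normal_pdf_ge0// expr_le_cosh.
rewrite -mulrA ler_wpM2l// mulrDl mulr2n -{1}(mul1r v) -mulN1r !expR_normal_pdf//.
rewrite sqrrN expr1n mul1r.
by rewrite lerD// ler_wpM2l ?expR_ge0// normal_pdf_ub// gt_eqF.
Qed.

Lemma cvg_expr_normal_pdf (k : nat) (u : nat -> R) :
  (forall n, `|u n| = n%:R) ->
  u n ^+ k * normal_pdf 0 s (u n) @[n --> \oo] --> 0.
Proof.
move=> un; have [C hC] := normal_expr_bounded k.
have C0 : C * n%:R^-1 @[n --> \oo] --> (0 : R).
  rewrite -(mulr0 C); apply: cvgM; first exact: cvg_cst.
  apply/gtr0_cvgV0; last exact: cvgr_idn.
  by near=> n; near: n; exact: nbhs_infty_gtr.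
apply: norm_cvg0; apply: (squeeze_cvgr _ (cvg_cst 0) C0); near=> n.
have n0 : 0 < n%:R :> R by near: n; exact: nbhs_infty_gtr.
rewrite normr_ge0/= ler_pdivlMr// -(un n) -normrM.
by apply: le_trans (hC (u n)); rewrite mulrAC -exprSr.
Unshelve. all: by end_near. Qed.

(** Gaussian integration by parts: the density satisfies p' = - (v / s^2) p, so the integrand [f] is
    the derivative of - v^k p. For [k = 0] the truncated predecessor is harmless, its coefficient
    being zero. *)
Lemma normal_moment_rec (k : nat) :
  (\int[N]_x (x ^+ k.+1)%:E = (k%:R * s ^+ 2)%:E * \int[N]_x (x ^+ k.-1)%:E)%E.
Proof.
pose f x : R := (x ^+ k.+1 / s ^+ 2 - k%:R * x ^+ k.-1) * normal_pdf 0 s x.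
pose F x : R := - (x ^+ k * normal_pdf 0 s x).
have fi : N.-integrable setT
    (fun x => ((s ^+ 2)^-1%:E * (x ^+ k.+1)%:E - k%:R%:E * (x ^+ k.-1)%:E)%E).
  by apply: integrableB => //; apply: integrableZl => //;
    exact: normal_integrable_expr.
have [fi' E] := integral_normal_prob fi.
have : (\int[mu]_x (f x)%:E = 0)%E.
  apply: (@integralT_derive0 _ f F).
  - move=> x; apply: cvgM; last by apply: continuous_normal_pdf; rewrite gt_eqF.
    by apply: cvgB; apply: cvgM; try exact: cvg_cst; exact: exprn_continuous.
  - move=> x.
    have := is_derive_normal_pdf x => dpdf.
    rewrite /F (_ : (fun _ => _) = - ((@id R ^+ k) * normal_pdf 0 s)); last first.
      by apply/funext => y; rewrite !fctE.
    apply: is_derive_eq; rewrite !fctE /f /= /GRing.scale/= (exprS x k).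
    by field; rewrite gt_eqF.
  - move: fi'; apply: eq_integrable => // x _; rewrite /f /=.
    by rewrite (mulrC (x ^+ k.+1)).
  - rewrite -oppr0; apply: cvgN; apply: cvg_expr_normal_pdf => n.
    by rewrite normr_nat.
  - rewrite -oppr0; apply: cvgN; apply: cvg_expr_normal_pdf => n.
    by rewrite normrN normr_nat.
move=> f0.
have : (\int[N]_x ((s ^+ 2)^-1%:E * (x ^+ k.+1)%:E - k%:R%:E * (x ^+ k.-1)%:E) = 0)%E.
  rewrite E -f0; apply: eq_integral => x _.
  by rewrite /f (mulrC (x ^+ k.+1)).
have Ik n := normal_integrable_expr s0 n.
rewrite integralB//; last 2 first.
- exact/integrableZl.
- exact/integrableZl.
rewrite !integralZl//.
set a := (\int[_]_x _)%E; set b := (\int[_]_x _)%E.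
have : a \is a fin_num by exact: integrable_fin_num.
have : b \is a fin_num by exact: integrable_fin_num.
move: a b => [a||] [b||]//= _ _; rewrite -!EFinM -EFinB => -[].
move=> /eqP; rewrite subr_eq0 mulrC => /eqP h; congr EFin.
by rewrite mulrAC -h divfK// expf_neq0 ?gt_eqF.
Qed.

Lemma normal_moments :
  [/\ (\int[N]_x (x ^+ 1)%:E = 0)%E, (\int[N]_x (x ^+ 2)%:E = (s ^+ 2)%:E)%E,
    (\int[N]_x (x ^+ 3)%:E = 0)%E & (\int[N]_x (x ^+ 4)%:E = (3 * s ^+ 4)%:E)%E].
Proof.
have m0 : (\int[N]_x (x ^+ 0)%:E = 1)%E.
  under eq_integral do rewrite expr0.
  by rewrite integral_cst// mul1e; exact: (@probability_setT _ _ _ (normal_prob 0 s)).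
have m1 := normal_moment_rec 0; rewrite /= !mul0r mul0e in m1.
have m2 := normal_moment_rec 1; rewrite /= mul1r m0 mule1 in m2.
have m3 := normal_moment_rec 2; rewrite /= m1 mule0 in m3.
have m4 := normal_moment_rec 3; rewrite /= m2 -EFinM in m4.
by split => //; rewrite m4; congr EFin; ring.
Qed.

End normal_moment_recursion.

(** * Independence of the past *)

Section product_rule.
Context d (T : measurableType d) (R : realType) (P : probability T R).

(** The product rule on rectangles identifies the joint law with the product of the two laws.
    Tonelli for |u v| gives integrability, then Fubini factors the integral of u v. *)
Lemma integralM_of_product_rule (X Y : {RV P >-> R}) :
  (forall A B, measurable A -> measurable B ->
    P (X @^-1` A `&` Y @^-1` B) = (P (X @^-1` A) * P (Y @^-1` B))%E) ->
  P.-integrable setT (EFin \o X) -> P.-integrable setT (EFin \o Y) ->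
  P.-integrable setT (EFin \o (X \* Y)) /\
  (\int[P]_w ((X \* Y) w)%:E = \int[P]_w (X w)%:E * \int[P]_w (Y w)%:E)%E.
Proof.
move=> XY iX iY.
have mXY : measurable_fun setT (fun w => (X w, Y w)) by exact/measurable_fun_pairP.
pose Z : {mfun T >-> (R * R)%type} :=
  HB.pack (fun w => (X w, Y w)) (isMeasurableFun.Build _ _ _ _ _ mXY).
have lawZ A : measurable A -> (distribution P X \x distribution P Y)%E A =
    distribution P Z A.
  by apply: product_measure_unique => B C mB mC; exact: XY.
pose h (z : R * R) : \bar R := (z.1 * z.2)%:E.
have mh : measurable_fun setT h.
  apply/measurable_EFinP; apply: measurable_funM;
    [exact: measurable_fst | exact: measurable_snd].
have absX : (\int[distribution P X]_u `|u%:E|)%E \is a fin_num.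
  rewrite ge0_integral_distribution//; last exact: measurableT_comp.
  by apply: integrable_fin_num => //; exact: integrable_abse.
have absY : (\int[distribution P Y]_u `|u%:E|)%E \is a fin_num.
  rewrite ge0_integral_distribution//; last exact: measurableT_comp.
  by apply: integrable_fin_num => //; exact: integrable_abse.
have hfubini : (distribution P X \x distribution P Y)%E.-integrable setT h.
  apply/integrable12ltyP => //.
  rewrite (eq_integral (fun u : R => `|u%:E| * \int[distribution P Y]_v `|v%:E|)%E); last first.
    move=> u _; rewrite -ge0_integralZl//; last exact: measurableT_comp.
    by apply: eq_integral => v _; rewrite /h -abseM.
  rewrite ge0_integralZr//; last 2 first.
  - exact: measurableT_comp.
  - exact: integral_ge0.
  by rewrite ltey_eq fin_numM.
have hZ : (distribution P Z).-integrable setT h.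
  apply/integrableP; split => //.
  rewrite (eq_measure_integral (distribution P X \x distribution P Y)%E).
    by have /integrableP[] := hfubini.
  by move=> A mA _; apply/esym; exact: lawZ.
have iZ : P.-integrable setT (EFin \o (X \* Y)).
  apply/integrableP; split.
    exact/measurable_EFinP/measurable_funM.
  have /integrableP[_] := hZ; rewrite ge0_integral_distribution//.
  exact: measurableT_comp.
split => //.
rewrite -(integral_distribution (X := Z) mh)//.
rewrite (eq_measure_integral (distribution P X \x distribution P Y)%E); last first.
  by move=> A mA _; apply/esym; exact: lawZ.
rewrite -integral12_prod_meas1//.
have iX' : (distribution P X).-integrable setT EFin by exact: integrable_pushforward.
have iY' : (distribution P Y).-integrable setT EFin by exact: integrable_pushforward.
rewrite (eq_integral (fun u : R => u%:E * \int[distribution P Y]_v v%:E)%E); last first.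
  by move=> u _; rewrite -integralZl//; apply: eq_integral => v _; rewrite /h EFinM.
have fY : (\int[distribution P Y]_v v%:E)%E \is a fin_num by exact: integrable_fin_num.
rewrite -(fineK fY) integralZr// fineK//.
by rewrite !integral_distribution.
Qed.

End product_rule.

Section past.
Context d (T : measurableType d) (R : realType) (P : probability T R).
Variable xi : nat -> {RV P >-> R}.

(** A pi-system, on which mutual independence is an explicit product, generating the sigma-algebra
    of [xi 0], ..., [xi k.-1]. Thus [adapted k] means known before the increment [xi k]. *)
Definition cylinder (k : nat) : set (set T) :=
  [set E | exists2 A : nat -> set R, (forall i, measurable (A i)) &
    E = \bigcap_(i in `I_k) (xi i @^-1` A i)].

Definition adapted (k : nat) (f : T -> R) :=
  @measurable_fun _ _ (g_sigma_algebraType (cylinder k)) R setT f.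

Lemma cylinder_measurable k : cylinder k `<=` measurable.
Proof.
move=> _ [A mA ->]; rewrite bigcap_mkcond.
apply: bigcapT_measurable => i; case: ifP => // _.
by rewrite -[X in measurable X]setTI; exact: measurable_funPT.
Qed.

Lemma cylinderT k : cylinder k setT.
Proof.
exists (fun=> setT) => //; apply/esym; rewrite -subTset => w _ i _; exact: I.
Qed.

Lemma cylinderI k : setI_closed (cylinder k).
Proof.
move=> _ _ [A mA ->] [B mB ->]; exists (fun i => A i `&` B i).
  by move=> i; exact: measurableI.
by rewrite -bigcapI; apply: eq_bigcapr => i _; rewrite preimage_setI.
Qed.

Lemma past_measurable k : <<s cylinder k >> `<=` measurable.
Proof.
apply: smallest_sub; first exact: sigma_algebra_measurable.
exact: cylinder_measurable.
Qed.

Lemma adapted_measurable k f : adapted k f -> measurable_fun setT f.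
Proof. by move=> mf _ A mA; apply: (@past_measurable k); exact: mf. Qed.

Lemma cylinderS k : cylinder k `<=` cylinder k.+1.
Proof.
move=> _ [A mA ->]; exists (fun i => if (i < k)%N then A i else setT).
  by move=> i; case: ifP.
apply/seteqP; split => w /= h i /= => [_|ik].
  by case: ifP => // ik; exact: h.
by have := h i; rewrite /= ik; apply; exact: ltnW.
Qed.

Lemma adaptedS k f : adapted k f -> adapted k.+1 f.
Proof.
move=> mf _ A mA; have := mf measurableT A mA; apply: sub_sigma_algebra2.
exact: cylinderS.
Qed.

Lemma adapted_cst k (a : R) : adapted k (fun=> a).
Proof. exact: measurable_cst. Qed.

Lemma adaptedD k f g : adapted k f -> adapted k g -> adapted k (fun w => f w + g w).
Proof. exact: measurable_funD. Qed.

Lemma adaptedM k f g : adapted k f -> adapted k g -> adapted k (fun w => f w * g w).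
Proof. exact: measurable_funM. Qed.

Lemma adaptedX k f n : adapted k f -> adapted k (fun w => f w ^+ n).
Proof. exact: measurable_funX. Qed.

Lemma adapted_sum k n (f : nat -> T -> R) : (forall i, (i < n)%N -> adapted k (f i)) ->
  adapted k (fun w => \sum_(i < n) f i w).
Proof.
elim: n => [|n IH] hf.
  by under eq_fun do rewrite big_ord0; exact: adapted_cst.
under eq_fun do rewrite big_ord_recr/=.
by apply: adaptedD; [apply: IH => i /ltnW; exact: hf|exact: hf].
Qed.

Lemma adapted_le j k f : (j <= k)%N -> adapted j f -> adapted k f.
Proof.
elim: k => [|k IH]; first by rewrite leqn0 => /eqP ->.
rewrite leq_eqVlt => /predU1P[-> //|jk af]; apply: adaptedS; exact: IH.
Qed.

Lemma adapted_increment k : adapted k.+1 (xi k).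
Proof.
move=> _ A mA; rewrite setTI; apply: sub_sigma_algebra.
exists (fun i => if i == k then A else setT); first by move=> i; case: ifP.
apply/seteqP; split => w /= h.
  by move=> i _; case: eqP => [->//|].
by have := h k; rewrite /= eqxx ltnS leqnn; exact.
Qed.

Hypothesis ind : forall n, mutually_independent P (fun i : 'I_n => (xi i : T -> R)).

Lemma cylinder_prob n (A : nat -> set R) : (forall i, measurable (A i)) ->
  P (\bigcap_(i in `I_n) (xi i @^-1` A i)) = (\prod_(i < n) P (xi i @^-1` A i))%E.
Proof.
move=> mA; rewrite -(ind (A := fun i : 'I_n => A i))//; congr (P _).
apply/seteqP; split => w /= h i.
  by move=> _; apply: h => /=.
by move=> lti; exact: (h (Ordinal lti)).
Qed.

(** As functions of [E] both sides are finite measures, so it is enough that they agree on the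
    generating pi-system. *)
Lemma past_product_rule k (E : set T) (A : set R) : <<s cylinder k >> E ->
  measurable A -> P (E `&` xi k @^-1` A) = (P E * P (xi k @^-1` A))%E.
Proof.
move=> sE mA; set D := xi k @^-1` A.
have mD : measurable D by rewrite -[D]setTI; exact: measurable_funPT.
have PD0 : 0 <= fine (P D) by rewrite fine_ge0.
pose m2 := mscale (NngNum PD0) P.
have m2E F : m2 F = (P F * P D)%E.
  by rewrite /m2 /mscale /= fineK ?fin_num_measure// muleC.
rewrite -m2E.
apply: (@g_sigma_algebra_measure_unique _ _ _ (cylinder k) _ (fun=> setT) _ _
  (mrestr P mD) m2) => //.
- exact: cylinder_measurable.
- by move=> _; exact: cylinderT.
- by rewrite bigcup_const.
- exact: cylinderI.
- move=> _ [B mB ->]; rewrite [RHS]m2E.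
  (* Appending the constraint [A] at index [k] turns the intersection into a cylinder of [k.+1]
     increments. *)
  pose C i := if (i < k)%N then B i else A.
  have mC i : measurable (C i) by rewrite /C; case: ifP.
  have := @cylinder_prob k.+1 C mC.
  rewrite big_ord_recr/= {3}/C /= ltnn => E1.
  rewrite (@cylinder_prob k B)//; transitivity (\prod_(i < k) P (xi i @^-1` C i) * P D)%E.
    rewrite -E1; congr (P _); apply/seteqP; split => w /=.
      move=> [wB wD] i /=; rewrite /C ltnS leq_eqVlt => /orP[/eqP ->|ik].
        by rewrite ltnn.
      by rewrite ik; exact: wB.
    move=> h; split; last by have := h k (ltnSn k); rewrite /C ltnn.
    by move=> i /= ik; have := h i (ltnW ik); rewrite /C ik.
  by congr (_ * _)%E; apply: eq_bigr => i _; rewrite /C ltn_ord.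
- by move=> _; rewrite -ge0_fin_numE// fin_num_measure.
Qed.

(** A measurable function of [xi k] inherits its independence of the past, since its preimages are
    preimages under [xi k]. *)
Lemma adapted_integralM k (f : T -> R) (g : R -> R) :
  adapted k f -> measurable_fun setT g ->
  P.-integrable setT (EFin \o f) -> P.-integrable setT (EFin \o (g \o xi k)) ->
  P.-integrable setT (fun w => (f w * g (xi k w))%:E) /\
  (\int[P]_w (f w * g (xi k w))%:E =
    \int[P]_w (f w)%:E * \int[P]_w (g (xi k w))%:E)%E.
Proof.
move=> af mg fi gi.
pose X : {RV P >-> R} :=
  HB.pack f (isMeasurableFun.Build _ _ _ _ _ (adapted_measurable af)).
have mgx : measurable_fun setT (g \o xi k) by exact: measurableT_comp.
pose Y : {RV P >-> R} := HB.pack (g \o xi k) (isMeasurableFun.Build _ _ _ _ _ mgx).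
apply: (@integralM_of_product_rule _ _ _ _ X Y) => // A B mA mB.
rewrite (_ : Y @^-1` B = xi k @^-1` (g @^-1` B))//.
apply: past_product_rule.
  by have := af measurableT A mA; rewrite setTI.
by have := mg measurableT B mB; rewrite setTI.
Qed.

End past.

(** * Optional stopping in discrete time *)

Section stopping.
Implicit Types (b : nat -> bool) (N k : nat).

Definition alive b k := all b (iota 0 k.+1).
(** [find] returns the length of the list when nothing is found, so this is the first failure of [b]
    capped at [N]; for [k < N], [alive b k] says that it comes after [k]. *)
Definition stop b N := find (predC b) (iota 0 N).

Lemma aliveS b k : alive b k.+1 = alive b k && b k.+1.
Proof. by rewrite /alive -(addn1 k.+1) iotaD all_cat /= andbT. Qed.

Lemma alive0 b : alive b 0 = b 0%N. Proof. by rewrite /alive /= andbT. Qed.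

Lemma stop_le b N : (stop b N <= N)%N.
Proof. by rewrite -[leqRHS](size_iota 0) find_size. Qed.

Lemma lt_stop b N j : (j < stop b N)%N -> b j.
Proof.
move=> js; have := before_find 0%N js.
by rewrite nth_iota ?add0n/= => [/negbFE//|]; apply: leq_trans (stop_le b N).
Qed.

Lemma stop_hit b N : (stop b N < N)%N -> ~~ b (stop b N).
Proof.
move=> h; have : has (predC b) (iota 0 N) by rewrite has_find size_iota.
by move=> /(nth_find 0%N); rewrite nth_iota.
Qed.

Lemma stop_leq b N j : ~~ b j -> (stop b N <= j)%N.
Proof. by move=> bj; rewrite leqNgt; apply/negP => /lt_stop; exact/negP. Qed.

(** Telescoping: the differences that survive the factor [alive b k] are those with [k] below the
    stop. This writes a stopped process as a martingale transform. *)
Lemma stopped_sum (R : nzRingType) (M : nat -> R) b N :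
  M (stop b N) = M 0%N + \sum_(k < N) (alive b k)%:R * (M k.+1 - M k).
Proof.
elim: N => [|N IH]; first by rewrite big_ord0 addr0.
rewrite big_ord_recr/= addrA -IH /stop -(addn1 N) iotaD find_cat size_iota /=.
have -> : alive b N = ~~ has (predC b) (iota 0 N) && b N.
  by rewrite /alive -(addn1 N) iotaD all_cat /= andbT -all_predC; congr andb;
    apply: eq_all => i /=; rewrite negbK.
case: ifPn => [_|hN] /=; first by rewrite mul0r addr0.
rewrite [find _ _](_ : _ = N); last by move: hN => /hasNfind; rewrite size_iota.
by case: (b N) => /=; rewrite ?addn0 ?addn1 ?mul0r ?addr0// mul1r addrC subrK.
Qed.

End stopping.

Section optional_stopping.
Context d (T : measurableType d) (R : realType) (P : probability T R).

(** Optional stopping at a bounded index. The hypothesis concerns the differences already multiplied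
    by the survival indicator, the form that independence of the past delivers. *)
Lemma integral_stopped (M : nat -> T -> R) (b : nat -> T -> bool) N :
  P.-integrable setT (EFin \o M 0%N) ->
  (forall k, (k < N)%N ->
    P.-integrable setT
      (fun w => ((alive (b ^~ w) k)%:R * (M k.+1 w - M k w))%:E) /\
    (\int[P]_w ((alive (b ^~ w) k)%:R * (M k.+1 w - M k w))%:E = 0)%E) ->
  P.-integrable setT (fun w => (M (stop (b ^~ w) N) w)%:E) /\
  (\int[P]_w (M (stop (b ^~ w) N) w)%:E = \int[P]_w (M 0%N w)%:E)%E.
Proof.
move=> iM0 h.
pose D k w := ((alive (b ^~ w) k)%:R * (M k.+1 w - M k w))%:E.
have iD (k : 'I_N) : P.-integrable setT (D k) by case: (h k (ltn_ord k)).
have E : (fun w => (M (stop (b ^~ w) N) w)%:E) =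
    (fun w => (M 0%N w)%:E + \sum_(k < N) D k w)%E.
  apply/funext => w; rewrite (stopped_sum (M ^~ w)) EFinD; congr (_ + _)%E.
  by rewrite -sumEFin.
have iS : P.-integrable setT (fun w => \sum_(k < N) D k w)%E.
  by apply: integrable_sum.
rewrite E; split; first exact: integrableD.
rewrite integralD// integral_sum// big1 ?adde0// => k _.
by case: (h k (ltn_ord k)).
Qed.

Variable xi : nat -> {RV P >-> R}.

Lemma adapted_alive (b : nat -> T -> bool) k :
  (forall i, (i <= k)%N -> adapted xi i (fun w => (b i w)%:R)) ->
  adapted xi k (fun w => (alive (b ^~ w) k)%:R).
Proof.
elim: k => [|k IH] ab.
  rewrite (_ : (fun w => _) = (fun w => (b 0%N w)%:R)); first exact: ab.
  by apply/funext => w; rewrite alive0.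
rewrite (_ : (fun w => _) =
    (fun w => (alive (b ^~ w) k)%:R * (b k.+1 w)%:R)); last first.
  by apply/funext => w; rewrite aliveS -mulnb natrM.
apply: adaptedM.
  by apply: adaptedS; apply: IH => i ik; apply: ab; exact: leqW.
exact: ab.
Qed.

End optional_stopping.

(** * Gaussian random walks *)

Section gaussian_walk.
Context d (T : measurableType d) (R : realType) (P : probability T R).
Variables (xi : nat -> {RV P >-> R}) (s : R).
Hypothesis s0 : 0 < s.
Hypothesis ind : forall n, mutually_independent P (fun i : 'I_n => (xi i : T -> R)).
Hypothesis law : forall k (A : set R), measurable A ->
  P (xi k @^-1` A) = normal_prob 0 s A.

Definition walk k w : R := \sum_(i < k) xi i w.

Lemma walk0 w : walk 0 w = 0. Proof. by rewrite /walk big_ord0. Qed.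

Lemma walkS k w : walk k.+1 w = walk k w + xi k w.
Proof. by rewrite /walk big_ord_recr. Qed.

Lemma adapted_walk k : adapted xi k (walk k).
Proof.
apply: (adapted_sum (f := fun i w => xi i w)) => i ik.
by apply: (adapted_le ik); exact: adapted_increment.
Qed.

(* [normal_prob] is a measure on [measurableTypeR R], a copy of [R] whose display
   differs from that of [R]. *)
Let incr k : {mfun T >-> measurableTypeR R} :=
  HB.pack (xi k : T -> measurableTypeR R)
    (isMeasurableFun.Build _ _ T (measurableTypeR R) (xi k) (measurable_funPT (xi k))).

Lemma ge0_integral_increment k (g : measurableTypeR R -> \bar R) :
  measurable_fun setT g -> (forall v, 0 <= g v)%E ->
  (\int[P]_w g (xi k w) = \int[normal_prob 0 s]_v g v)%E.
Proof.
move=> mg g0; rewrite -(ge0_integral_distribution (incr k) mg g0).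
by apply: eq_measure_integral => A mA _; exact: law.
Qed.

Lemma integral_increment k (g : measurableTypeR R -> R) :
  (normal_prob 0 s).-integrable setT (EFin \o g) ->
  P.-integrable setT (EFin \o (g \o xi k)) /\
  (\int[P]_w (g (xi k w))%:E = \int[normal_prob 0 s]_v (g v)%:E)%E.
Proof.
move=> gi; have mg : measurable_fun setT (EFin \o g) by exact: measurable_int gi.
have gi' : P.-integrable setT (EFin \o (g \o xi k)).
  apply/integrableP; split; first exact: (measurableT_comp mg (measurable_funPT (incr k))).
  rewrite (ge0_integral_increment k (g := fun v => `|(g v)%:E|%E))//.
    by have /integrableP[] := gi.
  exact: measurableT_comp.
split => //; rewrite -(integral_distribution (X := incr k) mg)//.
by apply: eq_measure_integral => A mA _; exact: law.
Qed.

(** A factor known from the past is independent of the centred variable [g (xi k)], so the mean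
    factors through zero. Both the exponential and the polynomial martingales rest on this. *)
Lemma integral_martingale_difference k (f : T -> R) (g : R -> R) :
  adapted xi k f -> P.-integrable setT (EFin \o f) ->
  (normal_prob 0 s).-integrable setT (EFin \o g) ->
  (\int[normal_prob 0 s]_v (g v)%:E = 0)%E ->
  P.-integrable setT (fun w => (f w * g (xi k w))%:E) /\
  (\int[P]_w (f w * g (xi k w))%:E = 0)%E.
Proof.
move=> af fi gi g0; have [gi' Eg] := integral_increment k gi.
have mg : measurable_fun setT g.
  by apply/measurable_EFinP; exact: measurable_int gi.
have [? ->] := adapted_integralM ind af mg fi gi'.
by rewrite Eg g0 mule0.
Qed.

Section maximal_inequality.
Variable t : R.

(** Wald's martingale: by [normal_mgf] it is a product of independent factors of mean one. *)
Definition exp_martingale k w : R :=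
  expR (t * walk k w - k%:R * (t ^+ 2 * s ^+ 2 / 2)).

Let g (v : R) : R := expR (- (t ^+ 2 * s ^+ 2 / 2)) * expR (t * v).

Let gi : (normal_prob 0 s).-integrable setT (EFin \o g).
Proof.
apply/integrableP; split.
  apply/measurable_EFinP; apply: measurable_funM => //.
  exact: measurableT_comp.
under eq_integral do rewrite /= ger0_norm ?mulr_ge0 ?expR_ge0// EFinM.
rewrite ge0_integralZl// ?normal_mgf// -?EFinM ?ltry//.
by apply/measurable_EFinP; exact: measurableT_comp.
Qed.

Let Eg : (\int[normal_prob 0 s]_v (g v)%:E = 1)%E.
Proof.
under eq_integral do rewrite EFinM.
rewrite ge0_integralZl//.
- by rewrite normal_mgf// -EFinM -expRD addNr expR0.
- by apply/measurable_EFinP; exact: measurableT_comp.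
Qed.

Let exp_martingaleS k w :
  exp_martingale k.+1 w = exp_martingale k w * g (xi k w).
Proof.
rewrite /exp_martingale /g -!expRD walkS; congr expR.
by rewrite -natr1; ring.
Qed.

Let adapted_exp_martingale k : adapted xi k (exp_martingale k).
Proof.
apply: (measurableT_comp (f := expR)) => //.
apply: measurable_funB => //; apply: measurable_funM => //.
exact: adapted_walk.
Qed.

Let integrable_exp_martingale k : P.-integrable setT (EFin \o exp_martingale k).
Proof.
elim: k => [|k IH].
  rewrite (_ : _ \o _ = cst 1%:E); first exact: finite_measure_integrable_cst.
  by apply/funext => w /=; rewrite /exp_martingale walk0 mulr0 mul0r subr0 expR0.
have [gi' _] := integral_increment k gi.
have mg : measurable_fun setT g.
  by apply/measurable_EFinP; exact: measurable_int gi.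
have [+ _] := adapted_integralM ind (@adapted_exp_martingale k) mg IH gi'.
by apply: eq_integrable => // w _ /=; rewrite exp_martingaleS.
Qed.

(** Stop when the martingale first reaches [expR l], or at [N]. The stopped value has mean one, and
    on the event it is at least [expR l]. *)
Lemma exp_maximal_inequality N (l : R) :
  (P (\big[setU/set0]_(i < N.+1)
     [set w | (l <= t * walk i w - i%:R * (t ^+ 2 * s ^+ 2 / 2))%R]) <=
   (expR (- l))%:E)%E.
Proof.
pose b i w := exp_martingale i w < expR l.
have ab i : adapted xi i (fun w => (b i w)%:R).
  apply: (measurableT_comp (f := fun x : bool => x%:R : R)) => //.
  apply: measurable_fun_ltr => //; exact: adapted_exp_martingale.
have [] := @integral_stopped _ _ _ P exp_martingale b N.
- exact: integrable_exp_martingale.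
- move=> k _.
  have af : adapted xi k (fun w => (alive (b ^~ w) k)%:R * exp_martingale k w).
    apply: adaptedM.
      by apply: adapted_alive => i _; exact: ab.
    exact: adapted_exp_martingale.
  have fi : P.-integrable setT
      (EFin \o (fun w => (alive (b ^~ w) k)%:R * exp_martingale k w)).
    apply: le_integrable (integrable_exp_martingale k) => //.
      by apply/measurable_EFinP; exact: adapted_measurable af.
    move=> w _ /=; rewrite lee_fin normrM; case: alive; first by rewrite normr1 mul1r.
    by rewrite normr0 mul0r.
  have gi1 : (normal_prob 0 s).-integrable setT (EFin \o (fun v => g v - 1)).
    rewrite (_ : _ \o _ = (EFin \o g) \- cst 1%:E)%E; last first.
      by apply/funext => v /=.
    apply: integrableB => //; exact: finite_measure_integrable_cst.
  have [|+ +] := integral_martingale_difference af fi gi1.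
    rewrite (_ : (fun v => _) = (fun v => (g v)%:E - cst 1%:E v)%E); last first.
      by apply/funext.
    rewrite integralB//; last exact: finite_measure_integrable_cst.
    rewrite Eg [X in (1 - X)%E](_ : _ = 1%E) ?subee//.
    by rewrite integral_cst// mul1e; exact: (@probability_setT _ _ _ (normal_prob 0 s)).
  move=> h1 h2.
  have E w : ((alive (b ^~ w) k)%:R * exp_martingale k w * (g (xi k w) - 1))%:E =
     ((alive (b ^~ w) k)%:R * (exp_martingale k.+1 w - exp_martingale k w))%:E.
    by rewrite exp_martingaleS; congr EFin; ring.
  by under [in X in _ /\ X]eq_integral do rewrite -E; split => //;
    apply: eq_integrable h1.
- move=> iM EM.
  have M0 : (\int[P]_w (exp_martingale 0 w)%:E = 1)%E.
    rewrite (_ : (fun w => _) = cst 1%:E).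
      by rewrite integral_cst// mul1e; exact: probability_setT.
    by apply/funext => w /=; rewrite /exp_martingale walk0 mulr0 mul0r subr0 expR0.
  set V := \big[_/_]_(_ < _) _.
  pose F i := [set w | (l <= t * walk i w - i%:R * (t ^+ 2 * s ^+ 2 / 2))%R].
  have VE : V = \bigcup_(i in `I_N.+1) F i by rewrite bigcup_mkord.
  have mV : measurable V.
    apply: bigsetU_measurable => i _; rewrite -[X in measurable X]setTI.
    apply: measurable_fun_le => //.
    apply: measurable_funB => //; apply: measurable_funM => //.
    exact: (adapted_measurable (@adapted_walk i)).
  rewrite expRN; apply: (@le_trans _ _ ((expR l)^-1%:E * ((expR l)%:E * P V))%E).
    by rewrite muleA -EFinM mulVf ?mul1e// gt_eqF// expR_gt0.
  rewrite -[leRHS]mule1; apply: lee_wpmul2l; first by rewrite lee_fin invr_ge0 expR_ge0.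
  rewrite -M0 -EM -(setIT V) -integral_indic// -ge0_integralZl//; last first.
    exact/measurable_EFinP/measurable_indic.
  apply: ge0_le_integral => //.
  + by apply: emeasurable_funM => //; exact/measurable_EFinP/measurable_indic.
  + exact: measurable_int iM.
  + move=> w _; rewrite -EFinM lee_fin indicE.
    case: (boolP (w \in V)) => [|_]; last by rewrite mulr0 expR_ge0.
    rewrite mulr1 inE VE => -[i /= iN]; rewrite /F /=.
    rewrite -ler_expR => hi; rewrite leNgt; apply/negP => hs.
    have [sN|sN] := ltnP (stop (b ^~ w) N) N.
      by have := stop_hit sN; rewrite /b hs.
    (* The remaining case is a stop at the cap with a value below the level. It is contradictory: at
       [i = N] the value would reach the level, and at [i < N] the stop would have come earlier. *)
    have : stop (b ^~ w) N = N by apply/eqP; rewrite eqn_leq stop_le sN.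
    move=> sE; rewrite sE in hs.
    move: iN; rewrite ltnS leq_eqVlt => /predU1P[iN|iN].
      by move: hi; rewrite iN leNgt => /negP; exact.
    have := @lt_stop (b ^~ w) N i; rewrite sE => /(_ iN).
    by rewrite /b /exp_martingale ltNge hi.
Qed.

End maximal_inequality.
End gaussian_walk.

(** * An integrable envelope for Brownian paths *)

Section brownian_grid.
Context d (T : measurableType d) (R : realType) (P : probability T R).
Variable B : R -> {RV P >-> R}.
Hypothesis hB : standard_brownian_motion B.

Definition increment (h : R) (k : nat) : {RV P >-> R} :=
  B (k.+1%:R * h) \- B (k%:R * h).

(* [B 0] is subtracted because it vanishes only almost surely. *)
Lemma walk_increment h k w : walk (increment h) k w = B (k%:R * h) w - B 0 w.
Proof.
elim: k => [|k IH]; first by rewrite walk0 mul0r subrr.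
by rewrite walkS IH /increment /=; lra.
Qed.

Lemma increment_independent h n : 0 < h ->
  mutually_independent P (fun i : 'I_n => increment h i : T -> R).
Proof.
move=> h0; apply: (sbm_independent_increments hB (t := fun i => i%:R * h)).
  by rewrite mul0r.
by move=> i _; rewrite ler_wpM2r ?ltW// ltr_nat.
Qed.

Lemma increment_law h k (A : set R) : 0 < h -> measurable A ->
  P (increment h k @^-1` A) = normal_prob 0 (Num.sqrt h) A.
Proof.
move=> h0 mA; have le0 : 0 <= k%:R * h by rewrite mulr_ge0// ltW.
have lt1 : k%:R * h < k.+1%:R * h by rewrite ltr_pM2r// ltr_nat.
have := sbm_gaussian_increments hB le0 lt1 mA.
by rewrite (_ : _ - _ = h)// -natr1; ring.
Qed.

(** Dyadic, so that the grids are nested: the exceedance events then increase with [n], and a point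
    of one grid belongs to all finer ones. *)
Definition mesh n : R := (2 ^+ n)^-1.

Lemma mesh_gt0 n : 0 < mesh n. Proof. by rewrite invr_gt0 exprn_gt0. Qed.

Lemma meshS n i : (i.*2)%:R * mesh n.+1 = i%:R * mesh n.
Proof.
rewrite /mesh exprS invfM -muln2 natrM -mulrA (mulrA 2%:R) mulfV ?mul1r//.
Qed.

Section exceedance.
Variables (c : R) (c0 : 0 < c).

(* At mesh [2^-n] the horizon of [4^n] steps is the time [2^n]. *)
Definition exceed (k n : nat) : set T := \bigcup_(i in `I_(4 ^ n).+1)
  [set w | k%:R + c * (i%:R * mesh n) < `|B (i%:R * mesh n) w - B 0 w| ].

Lemma measurable_exceed k n : measurable (exceed k n).
Proof.
rewrite /exceed bigcup_mkord; apply: bigsetU_measurable => i _.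
rewrite (_ : [set w | _] =
  (fun w => k%:R + c * (i%:R * mesh n) < `|B (i%:R * mesh n) w - B 0 w|)
    @^-1` [set true])//.
rewrite -[X in measurable X]setTI; apply: measurable_fun_ltr => //.
by apply: measurableT_comp => //; exact: measurable_funB.
Qed.

(** With tilt [2 * c] the compensator at time t is [2 * c] times c t, so crossing the line of height
    [k] and slope [c] pushes the exponent past [2 * c * k]. The two signs of the tilt serve the two
    signs of the path. *)
Lemma exceed_prob k n : (P (exceed k n) <= (2 * expR (- (2 * c * k%:R)))%:E)%E.
Proof.
have h0 := mesh_gt0 n.
have s0 : 0 < Num.sqrt (mesh n) by rewrite sqrtr_gt0.
have ind m := @increment_independent (mesh n) m h0.
have law j A := @increment_law _ j A h0.
pose F t i := [set w | 2 * c * k%:R <= t * walk (increment (mesh n)) i w -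
   i%:R * (t ^+ 2 * Num.sqrt (mesh n) ^+ 2 / 2)].
pose V t := \big[setU/set0]_(i < (4 ^ n).+1) F t i.
have VE t : V t = \bigcup_(i in `I_(4 ^ n).+1) F t i by rewrite bigcup_mkord.
have sub : exceed k n `<=` V (2 * c) `|` V (- (2 * c)).
  move=> w [i /= iN hi]; rewrite !VE.
  have E t : t ^+ 2 = (2 * c) ^+ 2 -> i%:R * (t ^+ 2 * Num.sqrt (mesh n) ^+ 2 / 2) =
      2 * c * (c * (i%:R * mesh n)).
    by move=> ->; rewrite sqr_sqrtr ?ltW//; field.
  have [u0|u0] := leP 0 (B (i%:R * mesh n) w - B 0 w).
    left; exists i => //; rewrite /F /= walk_increment E// -mulrBr.
    rewrite ler_pM2l ?mulr_gt0// lerBrDr ltW//.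
    by rewrite ger0_norm in hi.
  right; exists i => //; rewrite /F /= walk_increment E ?sqrrN// mulNr -mulrN -mulrBr.
  rewrite ler_pM2l ?mulr_gt0// lerBrDr ltW//.
  by rewrite ltr0_norm in hi.
have mV t : measurable (V t).
  apply: bigsetU_measurable => i _; rewrite -[X in measurable X]setTI.
  apply: measurable_fun_le => //.
  apply: measurable_funB => //; apply: measurable_funM => //.
  exact: (adapted_measurable (@adapted_walk _ _ _ _ (increment (mesh n)) i)).
have PV t : (P (V t) <= (expR (- (2 * c * k%:R)))%:E)%E.
  exact: exp_maximal_inequality s0 ind law _ _ _.
apply: (@le_trans _ _ (P (V (2 * c) `|` V (- (2 * c))))).
  by apply: le_measure => //; rewrite inE; [exact: measurable_exceed|exact: measurableU].
apply: (@le_trans _ _ (P (V (2 * c)%R) + P (V (- (2 * c))%R))%E).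
  exact: measureU2.
by move: PV; set e := expR _ => PV; rewrite (_ : 2 * e = e + e) ?EFinD; [exact: leeD|ring].
Qed.

Lemma exceed_nd k : nondecreasing_seq (exceed k).
Proof.
apply/nondecreasing_seqP => n; apply/subsetPset => w [i /= iN hi].
exists i.*2; last by rewrite /= meshS.
rewrite /= ltnS expnS -mul2n; rewrite ltnS in iN.
by apply: leq_mul.
Qed.

Definition exceed_ever k : set T := \bigcup_n exceed k n.

Lemma measurable_exceed_ever k : measurable (exceed_ever k).
Proof. by apply: bigcupT_measurable => n; exact: measurable_exceed. Qed.

Lemma exceed_ever_prob k : (P (exceed_ever k) <= (2 * expR (- (2 * c * k%:R)))%:E)%E.
Proof.
have h : P (exceed k n) @[n --> \oo] --> P (exceed_ever k).
  apply: nondecreasing_cvg_mu => //.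
  - by move=> n; exact: measurable_exceed.
  - exact: measurable_exceed_ever.
  - exact: exceed_nd.
rewrite -(cvg_lim _ h)//; apply: lime_le; first by apply/cvg_ex; eexists; exact: h.
by apply: nearW => n; exact: exceed_prob.
Qed.

(** The weights e^(c k) lose against probabilities of order e^(-2 c k), so the mean is bounded by a
    geometric series; yet the sum is at least e^(c k) for every line [k] that is exceeded. *)
Definition excess_series w : \bar R :=
  (\sum_(k <oo) (expR (c * k%:R) * \1_(exceed_ever k) w)%:E)%E.

Let excess_ge0 k w : (0 <= (expR (c * k%:R) * \1_(exceed_ever k) w)%:E)%E.
Proof. by rewrite lee_fin mulr_ge0 ?expR_ge0. Qed.

Lemma excess_series_integrable : P.-integrable setT excess_series.
Proof.
have me k : measurable_fun setT
    (fun w => (expR (c * k%:R) * \1_(exceed_ever k) w)%:E).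
  apply/measurable_EFinP/measurable_funM => //.
  exact/measurable_indic/measurable_exceed_ever.
apply/integrableP; split.
  by apply: ge0_emeasurable_sum => // k w _ _; exact: excess_ge0.
under eq_integral do rewrite gee0_abs ?nneseries_ge0//.
rewrite integral_nneseries//.
pose z := expR (- c).
have z1 : `|z| < 1 by rewrite ger0_norm ?expR_ge0// expR_lt1 oppr_lt0.
apply: (@le_lt_trans _ _ (2 * (1 - z)^-1)%:E); last exact: ltry.
apply: lime_le; first by apply: is_cvg_nneseries => k _ _; exact: integral_ge0.
apply: nearW => n.
apply: (@le_trans _ _ (\sum_(0 <= k < n) (geometric 2 z k)%:E)%E); last first.
  rewrite sumEFin lee_fin; apply: geometric_le_lim => //.
  by rewrite expR_gt0.
apply: lee_sum => k _.
under eq_integral do rewrite EFinM.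
rewrite ge0_integralZl//; last first.
  exact/measurable_EFinP/measurable_indic/measurable_exceed_ever.
rewrite integral_indic ?setIT//; last exact: measurable_exceed_ever.
apply: (@le_trans _ _ ((expR (c * k%:R))%:E * (2 * expR (- (2 * c * k%:R)))%:E)%E).
  by rewrite lee_wpmul2l ?exceed_ever_prob// lee_fin expR_ge0.
rewrite -EFinM lee_fin /geometric /= mulrCA -expRD /z -expRM_natr ler_wpM2l//.
by rewrite ler_expR; lra.
Qed.

Lemma expR_le_excess_series k w : exceed_ever k w ->
  ((expR (c * k%:R))%:E <= excess_series w)%E.
Proof.
move=> kw; apply: le_trans (nneseries_lim_ge k.+1 _) => //.
rewrite big_nat_recr//= indicE mem_set// mulr1 leeDr//.
by apply: sume_ge0 => i _; exact: excess_ge0.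
Qed.

Lemma exceed_ever_finite w : (excess_series w < +oo)%E ->
  exists k, ~ exceed_ever k w.
Proof.
move=> fin; apply/existsNP => all.
have E0 : (0 <= excess_series w)%E by exact: nneseries_ge0.
have /fineK E : excess_series w \is a fin_num by rewrite ge0_fin_numE.
have [k hk] : exists k : nat, fine (excess_series w) < c * k%:R.
  exists (Num.truncn (fine (excess_series w) / c)).+1.
  by rewrite mulrC -ltr_pdivrMr// truncnS_gt.
have := expR_le_excess_series (all k); rewrite -E lee_fin leNgt => /negP; apply.
by apply: (lt_le_trans hk); apply: le_trans (expR_ge1Dx _); rewrite lerDr.
Qed.

(* If the integer [K] is least such that [|B_t - B_0| <= K + c t] on the grids, then
   [K = 0] or [e^(c (K - 1))] is a term of the series; the constant comes from
   [e^y >= (y / 4)^4] at [y = c (K + 1)]. *)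
Definition envelope w : \bar R :=
  (((4 / c) ^+ 4 * expR (2 * c))%:E * excess_series w + 1%:E)%E.

Lemma envelope_integrable : P.-integrable setT envelope.
Proof.
apply: integrableD => //; last exact: finite_measure_integrable_cst.
by apply: integrableZl => //; exact: excess_series_integrable.
Qed.

Lemma envelope_bound w : (envelope w < +oo)%E ->
  exists2 K : R, 0 <= K & (((1 + K) ^+ 4)%:E <= envelope w)%E /\
  forall n i, (i <= 4 ^ n)%N ->
    `|B (i%:R * mesh n) w - B 0 w| <= K + c * (i%:R * mesh n).
Proof.
move=> fin; set C := (4 / c) ^+ 4 * expR (2 * c).
have C0 : 0 < C by rewrite mulr_gt0 ?expR_gt0// exprn_gt0// divr_gt0.
have finD : (excess_series w < +oo)%E.
  rewrite ltey; apply/eqP => E; move: fin.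
  by rewrite /envelope -/C E gt0_muley ?lte_fin// addye// ltxx.
have ex : exists k, `[< ~ exceed_ever k w >].
  by have [k hk] := exceed_ever_finite finD; exists k; exact/asboolP.
have [k /asboolP hk kmin] := ex_minnP ex.
exists k%:R; first exact: ler0n.
split; last first.
  move=> n i iN; rewrite leNgt; apply/negP => h; apply: hk; exists n => //.
  by exists i.
rewrite /envelope -/C; case: k hk kmin => [|k] _ kmin.
  rewrite addr0 expr1n leeDr//; apply: mule_ge0; first by rewrite lee_fin ltW.
  by apply: nneseries_ge0 => k _ _; exact: excess_ge0.
have : exceed_ever k w.
  by apply: contrapT => /asboolP/kmin; rewrite ltnn.
move=> /expR_le_excess_series hkD.
apply: (@le_trans _ _ (C%:E * (expR (c * k%:R))%:E)%E).
  rewrite -EFinM lee_fin /C -mulrA -expRD.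
  have -> : 2 * c + c * k%:R = (c * (1 + k.+1%:R) / 4) * 4%:R.
    by rewrite -natr1; field.
  rewrite expRM_natr -exprMn ler_pXn2r//; last 2 first.
  - by rewrite nnegrE.
  - by rewrite nnegrE mulr_ge0 ?expR_ge0// divr_ge0// ltW.
  rewrite -ler_pdivrMl ?divr_gt0//.
  apply: le_trans (expR_ge1Dx _); rewrite invf_div -mulrAC lerDr//.
rewrite -[leLHS]adde0; apply: leeD => //.
by rewrite lee_wpmul2l// lee_fin ltW.
Qed.

End exceedance.
End brownian_grid.

(** * Polynomial martingales on the grid *)

Section growth.
Context {R : realType} (Z : Type) (Q : Z -> Prop) (K : Z -> R).
Hypothesis K0 : forall z, Q z -> 0 <= K z.

(** The points of [Z] bundle whatever the constant must be uniform in: a path and its bound for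
    integrability on one grid, and also the grid and the level for dominated convergence. *)
Definition growth (p : nat) (f : Z -> R) :=
  exists2 C, 0 <= C & forall z, Q z -> `|f z| <= C * (1 + K z) ^+ p.

Lemma growth_cst (a : R) : growth 0 (fun=> a).
Proof. by exists `|a| => // z _; rewrite expr0 mulr1. Qed.

Lemma growthW p q f : (p <= q)%N -> growth p f -> growth q f.
Proof.
move=> pq [C C0 h]; exists C => // z Qz; apply: le_trans (h z Qz) _.
by rewrite ler_wpM2l// ler_weXn2l// lerDl K0.
Qed.

Lemma growthD p f g : growth p f -> growth p g -> growth p (fun z => f z + g z).
Proof.
move=> [C C0 hC] [D D0 hD]; exists (C + D); first exact: addr_ge0.
move=> z Qz; apply: le_trans (ler_normD _ _) _.
by rewrite mulrDl lerD// ?hC ?hD.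
Qed.

Lemma growthM p q f g : growth p f -> growth q g ->
  growth (p + q) (fun z => f z * g z).
Proof.
move=> [C C0 hC] [D D0 hD]; exists (C * D); first exact: mulr_ge0.
move=> z Qz; rewrite normrM exprD mulrACA.
by rewrite ler_pM// ?hC ?hD.
Qed.

Lemma growthX p n f : growth p f -> growth (p * n) (fun z => f z ^+ n).
Proof.
move=> hf; elim: n => [|n IH].
  by rewrite muln0; under eq_fun do rewrite expr0; exact: growth_cst.
by rewrite mulnS; under eq_fun do rewrite exprS; exact: growthM.
Qed.

Lemma growth_sum p n (f : nat -> Z -> R) : (forall i, (i < n)%N -> growth p (f i)) ->
  growth p (fun z => \sum_(i < n) f i z).
Proof.
elim: n => [|n IH] hf.
  by under eq_fun do rewrite big_ord0; exact: growthW (growth_cst _).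
under eq_fun do rewrite big_ord_recr/=.
by apply: growthD; [apply: IH => i /ltnW; exact: hf|exact: hf].
Qed.

End growth.

Section functional.
Context {R : realType}.
Variables (c : nat -> R) (q : nat -> R -> R).

(** Giving [t] and [y] weight 1 and [a] weight 2, no monomial exceeds weight 4, the power that the
    envelope absorbs. The terms in [q] vanish at [y = 0] and leave the quadratic polynomial whose
    mean is sought. *)
Definition functional (h t y a : R) : R :=
  q 0 h * y ^+ 4 + q 1 h * y ^+ 3 + (q 2 h + q 3 h * t + q 4 h * a) * y ^+ 2 +
  (q 5 h + q 6 h * t + q 7 h * a) * y +
  (c 0 * t + c 1 * a + c 2 * t ^+ 2 + c 3 * (t * a) + c 4 * a ^+ 2).

Definition fcoef1 (h t y a : R) : R :=
  4 * (q 0 h * y ^+ 3) + 3 * (q 1 h * y ^+ 2) +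
  2 * ((q 2 h + q 3 h * t + q 4 h * a) * y) + (q 5 h + q 6 h * t + q 7 h * a).

Definition fcoef2 (h t y a : R) : R :=
  6 * (q 0 h * y ^+ 2) + 3 * (q 1 h * y) + (q 2 h + q 3 h * t + q 4 h * a).

Definition fcoef3 (h t y a : R) : R := 4 * (q 0 h * y) + q 1 h.

Lemma functional_taylor h t y a v : functional h t (y + v) a =
  functional h t y a + fcoef1 h t y a * v + fcoef2 h t y a * v ^+ 2 +
  fcoef3 h t y a * v ^+ 3 + q 0 h * v ^+ 4.
Proof. by rewrite /functional /fcoef1 /fcoef2 /fcoef3; ring. Qed.

Section growth_functional.
Variables (Z : Type) (Q : Z -> Prop) (K : Z -> R) (h t y a : Z -> R).
Hypothesis K0 : forall z, Q z -> 0 <= K z.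
Hypotheses (gq : forall i, growth Q K 0 (fun z => q i (h z)))
  (gt : growth Q K 1 t) (gy : growth Q K 1 y) (ga : growth Q K 2 a).

Let gcst r p : growth Q K p (fun=> r).
Proof. exact: growthW (growth_cst _ _ _). Qed.

Let mulW p p' r f g : growth Q K p f -> growth Q K p' g -> (p + p' <= r)%N ->
  growth Q K r (fun z => f z * g z).
Proof. by move=> hf hg hr; apply: (growthW K0 hr); exact: growthM. Qed.

Let gqW i r : growth Q K r (fun z => q i (h z)).
Proof. exact: growthW (gq i). Qed.

Let glin i j k : growth Q K 2
  (fun z => q i (h z) + q j (h z) * t z + q k (h z) * a z).
Proof.
apply: growthD; first (apply: growthD; first exact: gqW).
  by apply: mulW (gq j) gt _.
by apply: mulW (gq k) ga _.
Qed.

Lemma growth_functional :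
  growth Q K 4 (fun z => functional (h z) (t z) (y z) (a z)).
Proof.
rewrite /functional.
apply: growthD; last first.
  apply: growthD; last by apply: mulW (gcst _ 0) (growthX 2 ga) _.
  apply: growthD; last by apply: mulW (gcst _ 0) (growthM gt ga) _.
  apply: growthD; last by apply: mulW (gcst _ 0) (growthX 2 gt) _.
  apply: growthD; first by apply: mulW (gcst _ 0) gt _.
  by apply: mulW (gcst _ 0) ga _.
apply: growthD; last by apply: mulW (glin 5 6 7) gy _.
apply: growthD; last by apply: mulW (glin 2 3 4) (growthX 2 gy) _.
apply: growthD; first by apply: mulW (gq 0) (growthX 4 gy) _.
by apply: mulW (gq 1) (growthX 3 gy) _.
Qed.

Lemma growth_fcoef1 : growth Q K 4 (fun z => fcoef1 (h z) (t z) (y z) (a z)).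
Proof.
apply: growthD; last by apply: growthW (glin 5 6 7).
apply: growthD; last by apply: mulW (gcst 2 0) (growthM (glin 2 3 4) gy) _.
apply: growthD; first by apply: mulW (gcst 4 0) (growthM (gq 0) (growthX 3 gy)) _.
by apply: mulW (gcst 3 0) (growthM (gq 1) (growthX 2 gy)) _.
Qed.

Lemma growth_fcoef2 : growth Q K 4 (fun z => fcoef2 (h z) (t z) (y z) (a z)).
Proof.
apply: growthD; last by apply: growthW (glin 2 3 4).
apply: growthD; first by apply: mulW (gcst 6 0) (growthM (gq 0) (growthX 2 gy)) _.
by apply: mulW (gcst 3 0) (growthM (gq 1) gy) _.
Qed.

Lemma growth_fcoef3 : growth Q K 4 (fun z => fcoef3 (h z) (t z) (y z) (a z)).
Proof.
apply: growthD; last exact: gqW.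
by apply: mulW (gcst 4 0) (growthM (gq 0) gy) _.
Qed.

End growth_functional.

(* By [functional_taylor], the average of [functional] at
   [(t + h, y - mu h + v, a + h y)] over [v] of law N(0, h) only involves, besides
   the value at [v = 0], the coefficients of [v^2] and [v^4], with [E v^2 = h] and
   [E v^4 = 3 h^2]. *)
Definition is_discrete_martingale (mu : R) := forall h t y a : R, 0 < h ->
  functional h (t + h) (y - mu * h) (a + h * y) +
  h * fcoef2 h (t + h) (y - mu * h) (a + h * y) + 3 * h ^+ 2 * q 0 h =
  functional h t y a.

End functional.

(** * Optional stopping of the polynomial martingales on one grid *)

Section stopped_functional.
Context d (T : measurableType d) (R : realType) (P : probability T R).
Variable B : R -> {RV P >-> R}.
Hypothesis hB : standard_brownian_motion B.
Variables (x mu : R).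

Definition grid_pos (h : R) (k : nat) (w : T) : R :=
  x - mu * (k%:R * h) + walk (increment B h) k w.

Definition grid_area (h : R) (k : nat) (w : T) : R :=
  \sum_(j < k) h * grid_pos h j w.

Lemma grid_posS h k w :
  grid_pos h k.+1 w = grid_pos h k w - mu * h + increment B h k w.
Proof. by rewrite /grid_pos walkS -natr1; ring. Qed.

Lemma grid_areaS h k w :
  grid_area h k.+1 w = grid_area h k w + h * grid_pos h k w.
Proof. by rewrite /grid_area big_ord_recr. Qed.

Lemma adapted_grid_pos h k : adapted (increment B h) k (grid_pos h k).
Proof. by apply: adaptedD; [exact: adapted_cst|exact: adapted_walk]. Qed.

Lemma adapted_grid_area h k : adapted (increment B h) k (grid_area h k).
Proof.
apply: (adapted_sum (f := fun j w => h * grid_pos h j w)) => j jk.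
apply: adaptedM; first exact: adapted_cst.
by apply: (adapted_le (ltnW jk)); exact: adapted_grid_pos.
Qed.

Variables (c : R) (c0 : 0 < c).

(** The bound is a coordinate of the point instead of a function of the path, so it never has to be
    chosen measurably. *)
Definition path_bound (n : nat) (z : T * R) : Prop := 0 <= z.2 /\
  forall i, (i <= 4 ^ n)%N ->
    `|B (i%:R * mesh R n) z.1 - B 0 z.1| <= z.2 + c * (i%:R * mesh R n).

Lemma growth_integrable n (f : T -> R) : measurable_fun setT f ->
  growth (path_bound n) snd 4 (f \o fst) -> P.-integrable setT (EFin \o f).
Proof.
(* [C] may be zero, and zero times an infinite envelope is zero; the strictly positive factor keeps
   the majorant infinite there. *)
move=> mf [C C0 hC]; have C1 : 0 < C + 1 by rewrite ltr_wpDl.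
apply: (@le_integrable _ _ _ P setT measurableT _
  (fun w => (C + 1)%:E * envelope B c w)%E).
- exact/measurable_EFinP.
- move=> w _ /=; have [fin|] := ltP (envelope B c w) +oo%E; last first.
    by rewrite leye_eq => /eqP ->; rewrite gt0_muley ?lte_fin// leey.
  have [K K0 [hK hBK]] := envelope_bound c0 fin.
  apply: (@le_trans _ _ ((C + 1)%:E * ((1 + K) ^+ 4)%:E)%E).
    rewrite -EFinM lee_fin; apply: (le_trans (hC (w, K) (conj K0 (hBK n)))).
    by rewrite ler_wpM2r ?exprn_ge0 ?addr_ge0// lerDl.
  apply: le_trans (lee_abs _); apply: lee_wpmul2l => //.
  by rewrite lee_fin ltW.
- exact: integrableZl (envelope_integrable hB c0).
Qed.

Lemma path_bound_ge0 n z : path_bound n z -> 0 <= z.2. Proof. by case. Qed.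

(** For integrability on one grid the constant may depend on [n] and [k], so the time
    [k%:R * mesh R n] is simply absorbed in it. This is also why the area has exponent 1 here. *)
Lemma growth_walk n k : (k <= 4 ^ n)%N ->
  growth (path_bound n) snd 1 (fun z => walk (increment B (mesh R n)) k z.1).
Proof.
move=> kn; exists (1 + c * (k%:R * mesh R n)).
  by rewrite addr_ge0// !mulr_ge0// ltW// mesh_gt0.
move=> [w K] [/= K0 /(_ k kn)]; rewrite walk_increment => /le_trans; apply.
have : 0 <= c * (k%:R * mesh R n) by rewrite !mulr_ge0// ltW// mesh_gt0.
rewrite expr1; nra.
Qed.

Lemma growth_grid_pos n k : (k <= 4 ^ n)%N ->
  growth (path_bound n) snd 1 (fun z => grid_pos (mesh R n) k z.1).
Proof.
move=> kn; apply: growthD; last exact: growth_walk.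
by apply: (growthW (@path_bound_ge0 n) _ (growth_cst _ _ _)).
Qed.

Lemma growth_grid_area n k : (k <= (4 ^ n).+1)%N ->
  growth (path_bound n) snd 1 (fun z => grid_area (mesh R n) k z.1).
Proof.
move=> kn; apply: (growth_sum (@path_bound_ge0 n)
  (f := fun i z => mesh R n * grid_pos (mesh R n) i z.1)) => i ik.
apply: (growthM (p := 0) (growth_cst _ _ _)); apply: growth_grid_pos.
by rewrite -ltnS (leq_trans ik).
Qed.

Variables (cf : nat -> R) (q : nat -> R -> R).
Hypothesis mart : is_discrete_martingale cf q mu.

Definition stop_index (eps : R) (n : nat) (w : T) : nat :=
  stop (fun k => eps < grid_pos (mesh R n) k w) (4 ^ n).

Definition stopped_functional (eps : R) (n : nat) (w : T) : R :=
  functional cf q (mesh R n) ((stop_index eps n w)%:R * mesh R n)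
    (grid_pos (mesh R n) (stop_index eps n w) w)
    (grid_area (mesh R n) (stop_index eps n w) w).

Lemma integral_stopped_functional eps n :
  P.-integrable setT (EFin \o stopped_functional eps n) /\
  (\int[P]_w (stopped_functional eps n w)%:E =
    (functional cf q (mesh R n) 0 x 0)%:E)%E.
Proof.
set h := mesh R n; have h0 : 0 < h by exact: mesh_gt0.
have s0 : 0 < Num.sqrt h by rewrite sqrtr_gt0.
have s2 : Num.sqrt h ^+ 2 = h by rewrite sqr_sqrtr// ltW.
pose b k w := eps < grid_pos h k w.
pose M k w := functional cf q h (k%:R * h) (grid_pos h k w) (grid_area h k w).
have ind m := @increment_independent _ _ _ _ _ hB h m h0.
have law j A := @increment_law _ _ _ _ _ hB h j A h0.
have M0 w : M 0%N w = functional cf q h 0 x 0.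
  rewrite /M /grid_pos /grid_area big_ord0 walk0 mul0r; congr functional; ring.
have mT f k : adapted (increment B h) k f -> measurable_fun setT f.
  exact: adapted_measurable.
have ab k : adapted (increment B h) k (fun w => (b k w)%:R).
  apply: (measurableT_comp (f := fun x : bool => x%:R : R)) => //.
  apply: measurable_fun_ltr; first exact: measurable_cst.
  exact: adapted_grid_pos.
have aalive k : adapted (increment B h) k (fun w => (alive (b ^~ w) k)%:R).
  by apply: adapted_alive => i _; exact: ab.
(* The next state without its noise. It is known at index [k]: the area, being a left Riemann sum,
   only uses the position before the step. *)
pose t' k := k%:R * h + h.
pose u k w := grid_pos h k w - mu * h.
pose a' k w := grid_area h k w + h * grid_pos h k w.
have au k : adapted (increment B h) k (u k).
  by apply: adaptedD; [exact: adapted_grid_pos|exact: adapted_cst].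
have aa' k : adapted (increment B h) k (a' k).
  apply: adaptedD; first exact: adapted_grid_area.
  by apply: adaptedM; [exact: adapted_cst|exact: adapted_grid_pos].
have afcoef1 k : adapted (increment B h) k (fun w => fcoef1 q h (t' k) (u k w) (a' k w)).
  by do ! first [exact: adapted_cst|exact: au|exact: aa'|apply: adaptedX|
    apply: adaptedM|apply: adaptedD].
have afcoef2 k : adapted (increment B h) k (fun w => fcoef2 q h (t' k) (u k w) (a' k w)).
  by do ! first [exact: adapted_cst|exact: au|exact: aa'|apply: adaptedX|
    apply: adaptedM|apply: adaptedD].
have afcoef3 k : adapted (increment B h) k (fun w => fcoef3 q h (t' k) (u k w) (a' k w)).
  by do ! first [exact: adapted_cst|exact: au|exact: aa'|apply: adaptedX|
    apply: adaptedM|apply: adaptedD].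
(* Common form of the four Taylor terms: an adapted coefficient [G], cut off by survival, times a
   centred power [g] of the increment. *)
have key k (G : R -> R -> R -> R -> R) (g : R -> R) : (k < 4 ^ n)%N ->
    adapted (increment B h) k (fun w => G h (t' k) (u k w) (a' k w)) ->
    growth (path_bound n) snd 4 (fun z => G h (t' k) (u k z.1) (a' k z.1)) ->
    (normal_prob 0 (Num.sqrt h)).-integrable setT (EFin \o g) ->
    (\int[normal_prob 0 (Num.sqrt h)]_v (g v)%:E = 0)%E ->
    P.-integrable setT (fun w => ((alive (b ^~ w) k)%:R * G h (t' k) (u k w) (a' k w) *
       g (increment B h k w))%:E) /\
    (\int[P]_w ((alive (b ^~ w) k)%:R * G h (t' k) (u k w) (a' k w) *
       g (increment B h k w))%:E = 0)%E.
  move=> kn aG gG gi g0.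
  have aaG : adapted (increment B h) k
      (fun w => (alive (b ^~ w) k)%:R * G h (t' k) (u k w) (a' k w)).
    exact: adaptedM.
  have fi : P.-integrable setT
      (EFin \o (fun w => (alive (b ^~ w) k)%:R * G h (t' k) (u k w) (a' k w))).
    apply: (@growth_integrable n); first exact: mT aaG.
    have [C C0 hC] := gG; exists C => // z Qz; apply: le_trans (hC z Qz).
    rewrite /= normrM; case: alive; first by rewrite normr1 mul1r.
    by rewrite normr0 mul0r.
  by have [h1 h2] := integral_martingale_difference ind law aaG fi gi g0.
have [m1 m2 m3 m4] := normal_moments s0.
have Nint k := normal_integrable_expr s0 k.
have N2 r j : (normal_prob 0 (Num.sqrt h)).-integrable setT
     (EFin \o (fun v => v ^+ j - r)).
  rewrite (_ : _ \o _ = (fun v => (v ^+ j)%:E - cst r%:E v)%E); last first.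
    by apply/funext => v /=.
  by apply: integrableB => //; exact: finite_measure_integrable_cst.
have E2 r j : (\int[normal_prob 0 (Num.sqrt h)]_v (v ^+ j)%:E = r%:E)%E ->
    (\int[normal_prob 0 (Num.sqrt h)]_v (v ^+ j - r)%:E = 0)%E.
  move=> hr.
  have ci : (normal_prob 0 (Num.sqrt h)).-integrable setT (cst r%:E).
    exact: finite_measure_integrable_cst.
  apply: etrans (integralB measurableT (Nint j) ci) _.
  rewrite hr [X in (_ - X)%E](_ : _ = r%:E) ?subee//.
  rewrite integral_cst// -[RHS]mule1; congr (_ * _)%E.
  exact: (@probability_setT _ _ _ (normal_prob 0 (Num.sqrt h))).
have gcst k r : growth (path_bound n) snd k (fun=> r).
  exact: (growthW (@path_bound_ge0 n) _ (growth_cst _ _ _)).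
have iM0 : P.-integrable setT (EFin \o M 0%N).
  rewrite (_ : EFin \o _ = cst (functional cf q h 0 x 0)%:E).
    exact: finite_measure_integrable_cst.
  by apply/funext => w /=; rewrite M0.
have [|iM EM] := @integral_stopped _ _ _ P M b (4 ^ n) iM0.
  move=> k kn.
  have gu : growth (path_bound n) snd 1 (fun z => u k z.1).
    by apply: growthD; [apply: growth_grid_pos; exact: ltnW|exact: gcst].
  have ga : growth (path_bound n) snd 2 (fun z => a' k z.1).
    apply: (growthW (@path_bound_ge0 n) (p := 1)) => //.
    apply: growthD; first by apply: growth_grid_area; rewrite leqW// ltnW.
    apply: (growthM (p := 0) (growth_cst _ _ _)); apply: growth_grid_pos.
    exact: ltnW.
  have gt : growth (path_bound n) snd 1 (fun=> t' k) by exact: gcst.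
  have gq i : growth (path_bound n) snd 0 (fun=> q i h) by exact: gcst.
  have [i1 e1] := @key k (fcoef1 q) (fun v => v ^+ 1 - 0) kn (afcoef1 k)
    (growth_fcoef1 (@path_bound_ge0 n) gq gt gu ga) (N2 _ _) (E2 _ _ m1).
  have [i2 e2] := @key k (fcoef2 q) (fun v => v ^+ 2 - Num.sqrt h ^+ 2) kn (afcoef2 k)
    (growth_fcoef2 (@path_bound_ge0 n) gq gt gu ga) (N2 _ _) (E2 _ _ m2).
  have [i3 e3] := @key k (fcoef3 q) (fun v => v ^+ 3 - 0) kn (afcoef3 k)
    (growth_fcoef3 (fun=> t' k) (fun z => a' k z.1) (@path_bound_ge0 n) gq gu) (N2 _ _) (E2 _ _ m3).
  have [i4 e4] := @key k (fun h _ _ _ => q 0 h) (fun v => v ^+ 4 - 3 * Num.sqrt h ^+ 4)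
    kn (@adapted_cst _ _ _ _ _ _ _) (gcst _ _) (N2 _ _) (E2 _ _ m4).
  (* By [mart] the current value is the functional at the noiseless next state plus the mean
     contributions of v^2 and v^4, so the Taylor expansion minus it leaves only centred powers. *)
  have E : (fun w => ((alive (b ^~ w) k)%:R * (M k.+1 w - M k w))%:E) =
    (fun w => (((alive (b ^~ w) k)%:R * fcoef1 q h (t' k) (u k w) (a' k w) *
       (increment B h k w ^+ 1 - 0))%:E +
     ((alive (b ^~ w) k)%:R * fcoef2 q h (t' k) (u k w) (a' k w) *
       (increment B h k w ^+ 2 - Num.sqrt h ^+ 2))%:E +
     ((alive (b ^~ w) k)%:R * fcoef3 q h (t' k) (u k w) (a' k w) *
       (increment B h k w ^+ 3 - 0))%:E +
     ((alive (b ^~ w) k)%:R * q 0 h *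
       (increment B h k w ^+ 4 - 3 * Num.sqrt h ^+ 4))%:E)%E).
    apply/funext => w; rewrite -!EFinD; congr EFin.
    have -> : Num.sqrt h ^+ 4 = h ^+ 2 by rewrite -{2}s2 -exprM.
    rewrite s2 /M grid_posS grid_areaS -natr1 mulrDl mul1r -/(u k w) -/(t' k) -/(a' k w).
    rewrite functional_taylor -(mart (k%:R * h) (grid_pos h k w) (grid_area h k w) h0).
    rewrite -/(u k w) -/(t' k) -/(a' k w); ring.
  have i12 := integrableD measurableT i1 i2.
  have i123 := integrableD measurableT i12 i3.
  rewrite E; split; first exact: (integrableD measurableT i123 i4).
  rewrite (integralD measurableT i123 i4) (integralD measurableT i12 i3).
  by rewrite (integralD measurableT i1 i2) e1 e2 e3 e4 !adde0.
rewrite /stopped_functional; split => //; rewrite EM.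
under eq_integral do rewrite M0.
rewrite integral_cst// -[RHS]mule1; congr (_ * _)%E; exact: probability_setT.
Qed.

End stopped_functional.

(** * Hitting times of continuous paths *)

Section continuous_path.
Context {R : realType}.

Lemma continuous_unif_segment (f : R -> R) (L e : R) : continuous f -> 0 < e ->
  exists2 r, 0 < r & forall s t, 0 <= s <= L -> `|s - t| < r -> `|f s - f t| < e.
Proof.
move=> cf e0; have /compact_near_coveringP/(_ _ (0%R^'+)
  (fun r s => forall t : R, `|s - t| < r -> `|f s - f t| < e)) := @segment_compact R 0 L.
have H : forall s, `[0, L]%classic s -> \forall s' \near s & r \near 0^'+,
    forall t : R, `|s' - t| < r -> `|f s' - f t| < e.
  move=> s _.
  have /cvgrPdist_lt/(_ (e / 2)) := cf s.
  rewrite divr_gt0// => /(_ isT) /nbhs_ballP[r /= r0 hr].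
  exists (ball s (r / 2), [set r' | 0 < r' < r / 2]) => /=.
    split; first by apply: nbhsx_ballx; rewrite divr_gt0.
    near=> r'; apply/andP; split; near: r'; first exact: nbhs_right_gt.
    by apply: nbhs_right_lt; rewrite divr_gt0.
  move=> [s' r'] /= [hs /andP[r'0 hr']] t st.
  have h1 : `|f s - f s'| < e / 2.
    by apply: hr; apply: lt_le_trans hs _; rewrite ler_pdivrMr// ler_pMr// ler1n.
  have h2 : `|f s - f t| < e / 2.
    apply: hr; rewrite /ball /= in hs *; rewrite (le_lt_trans (ler_distD s' _ _))//.
    by rewrite [ltRHS](splitr r) ltrD// (lt_trans st).
  rewrite (le_lt_trans (ler_distD (f s) _ _))// (distrC (f s')).
  by rewrite [ltRHS](splitr e) ltrD.
move=> /(_ _ H) h.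
have [r [r0 hr]] : exists r, 0 < r /\ forall s, 0 <= s <= L ->
    forall t : R, `|s - t| < r -> `|f s - f t| < e.
  near (0 : R)^'+ => r; exists r; split; first by near: r; exact: nbhs_right_gt.
  move=> s sL; have : `[0, L]%classic s by rewrite /= in_itv.
  by move: s {sL}; near: r; exact: h.
by exists r => // s t sL; exact: hr.
Unshelve. all: by end_near. Qed.

Variables (f : R -> R) (cf : continuous f).

Lemma continuous_dist (t e : R) : 0 < e ->
  exists2 r, 0 < r & forall s, `|s - t| < r -> `|f s - f t| < e.
Proof.
move=> e0; have /cvgrPdist_lt/(_ e e0)/nbhs_ballP[r /= r0 hr] := @cf t.
by exists r => // s st; rewrite distrC; apply: hr; rewrite /ball/= distrC.
Qed.

Section primitive.
Variable G : R -> R.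
Hypothesis G0 : G 0 = 0.
Hypothesis dG : forall t : R, 0 <= t -> is_derive t 1 G (f t).

Lemma primitive_continuous t : 0 <= t -> {for t, continuous G}.
Proof.
move=> /dG dGt; apply: differentiable_continuous.
by apply/derivable1_diffP; exact: ex_derive.
Qed.

(** By the mean value theorem each cell contributes h f(z) to [G] for some z in the cell, so it adds
    at most h e to the error. *)
Lemma riemann_error (L e r h : R) k : 0 < h -> h < r -> k%:R * h <= L ->
  (forall s t, 0 <= s <= L -> `|s - t| < r -> `|f s - f t| < e) ->
  `|\sum_(j < k) h * f (j%:R * h) - G (k%:R * h)| <= k%:R * h * e.
Proof.
move=> h0 hr; elim: k => [|k IH] kL hf.
  by rewrite big_ord0 mul0r G0 subrr normr0 !mul0r.
have kh : k%:R * h < k.+1%:R * h by rewrite ltr_pM2r// ltr_nat.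
have kh0 : 0 <= k%:R * h by rewrite mulr_ge0// ltW.
have [|||z zI Gz] := @MVT R G f (k%:R * h) (k.+1%:R * h) => //.
- by move=> z; rewrite in_itv/= => /andP[hz _]; apply: dG; exact: ltW (le_lt_trans _ hz).
- apply: continuous_in_subspaceT => z; rewrite inE/= in_itv/= => /andP[hz _].
  by apply: primitive_continuous; exact: le_trans hz.
have hk : k.+1%:R * h - k%:R * h = h by rewrite -natr1; ring.
rewrite hk in Gz; have -> : G (k.+1%:R * h) = G (k%:R * h) + f z * h by lra.
rewrite big_ord_recr/= (_ : _ - _ = (\sum_(j < k) h * f (j%:R * h) - G (k%:R * h)) +
   h * (f (k%:R * h) - f z)); last by ring.
rewrite (le_trans (ler_normD _ _))//.
have -> : k.+1%:R * h * e = k%:R * h * e + h * e by rewrite -natr1; ring.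
rewrite lerD ?IH ?(le_trans (ltW kh))//.
rewrite normrM gtr0_norm// ler_wpM2l ?ltW//; apply: hf.
  by rewrite kh0 (le_trans (ltW kh)).
move: zI; rewrite in_itv/= => /andP[z1 z2].
by rewrite ltr0_norm ?subr_lt0//; lra.
Qed.

Lemma cvg_mesh : mesh R n @[n --> \oo] --> 0.
Proof.
have : geometric 1 (2^-1 : R) @ \oo --> 0.
  by apply: cvg_geometric; rewrite ger0_norm// invf_lt1// ltr1n.
by apply: cvg_trans; apply: near_eq_cvg; near=> n; rewrite /mesh /geometric /= mul1r exprVn.
Unshelve. all: by end_near. Qed.

(** The upper limit moves with [n], but it eventually stays below [L]; oscillation [e / L] on that
    common segment makes the total error at most [e]. *)
Lemma riemann_cvg (k : nat -> nat) (s : R) : 0 <= s -> (k n)%:R * mesh R n @[n --> \oo] --> s ->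
  \sum_(j < k n) mesh R n * f (j%:R * mesh R n) @[n --> \oo] --> G s.
Proof.
move=> s0 ks; pose L := `|s| + 1; have L0 : 0 < L by rewrite ltr_wpDl.
have Gk : G ((k n)%:R * mesh R n) @[n --> \oo] --> G s.
  by apply: continuous_cvg => //; exact: primitive_continuous.
rewrite -[X in _ --> X]add0r.
rewrite (_ : (fun n => _) = fun n => (\sum_(j < k n) mesh R n * f (j%:R * mesh R n) -
  G ((k n)%:R * mesh R n)) + G ((k n)%:R * mesh R n)); last first.
  by apply/funext => n; rewrite subrK.
apply: cvgD => //; apply/cvgrPdist_le => e e0.
have [r r0 hr] := @continuous_unif_segment f L (e / L) cf (divr_gt0 e0 L0).
near=> n; rewrite sub0r normrN.
have kL : (k n)%:R * mesh R n <= L.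
  rewrite /L; near: n; move: ks => /cvgrPdist_le/(_ 1 ltr01); apply: filterS => n.
  by rewrite ler_norml => /andP[h1 h2]; have := ler_norm s; lra.
apply: (le_trans (riemann_error (mesh_gt0 R n) _ kL hr)).
  near: n; move: cvg_mesh => /cvgrPdist_lt/(_ r r0); apply: filterS => n.
  by rewrite sub0r normrN gtr0_norm ?mesh_gt0.
by rewrite mulrCA ler_piMr ?(ltW e0)// ler_pdivrMr// mul1r.
Unshelve. all: by end_near. Qed.

End primitive.

(** * The hitting time of a path and its approximation on grids *)

Section hitting.
Hypothesis f0 : 0 < f 0.
Hypothesis fneg : exists2 t, 0 < t & f t <= 0.

Definition hitting_time : R := inf [set t | 0 < t /\ f t <= 0].

Let S0 : [set t | 0 < t /\ f t <= 0] !=set0.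
Proof. by have [t t0 ft] := fneg; exists t. Qed.

Let lbS : has_lbound [set t | 0 < t /\ f t <= 0].
Proof. by exists 0 => t [/ltW]. Qed.

Lemma hitting_time_ereal :
  ereal_inf [set t%:E | t in [set t | 0 < t /\ f t <= 0]] = hitting_time%:E.
Proof. exact: ereal_inf_EFin. Qed.

Let T0_ge0 : 0 <= hitting_time.
Proof. by apply: lb_le_inf => // t [/ltW]. Qed.

Lemma hitting_time_value_le0 : f hitting_time <= 0.
Proof.
rewrite leNgt; apply/negP => fT; have [r r0 hr] := continuous_dist hitting_time fT.
have [t [t0 ft] tT] := inf_adherent r0 (conj S0 lbS).
have Tt : hitting_time <= t by apply: ge_inf.
have : `|f t - f hitting_time| < f hitting_time.
  by apply: hr; rewrite ger0_norm ?subr_ge0// ltrBlDl.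
by rewrite ltr_norml => /andP[h _]; lra.
Qed.

Lemma hitting_time_gt0 : 0 < hitting_time.
Proof.
rewrite lt_neqAle T0_ge0 andbT; apply/eqP => E.
by move: hitting_time_value_le0; rewrite -E leNgt f0.
Qed.

Lemma before_hitting_time t : 0 <= t < hitting_time -> 0 < f t.
Proof.
move=> /andP[]; rewrite le_eqVlt => /predU1P[<- //|t0] tT.
by rewrite ltNge; apply/negP => ft; move: tT; rewrite ltNge => /negP; apply; exact: ge_inf.
Qed.

Lemma hitting_time_value : f hitting_time = 0.
Proof.
apply/eqP; rewrite eq_le hitting_time_value_le0 leNgt; apply/negP => fT.
have [r r0 hr] : exists2 r, 0 < r & forall s, `|s - hitting_time| < r ->
   `|f s - f hitting_time| < - f hitting_time.
  by apply: continuous_dist; rewrite oppr_gt0.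
(* A slightly earlier time, where the path would still be negative; the minimum keeps it
   nonnegative, as [before_hitting_time] demands. *)
pose t := hitting_time - Num.min (r / 2) hitting_time.
have m0 : 0 < Num.min (r / 2) hitting_time.
  by rewrite lt_min divr_gt0// hitting_time_gt0.
have mr : Num.min (r / 2) hitting_time < r.
  by rewrite gt_min; apply/orP; left; lra.
have : 0 < f t.
  apply: before_hitting_time; rewrite /t subr_ge0 ge_min lexx orbT/=; lra.
have : `|f t - f hitting_time| < - f hitting_time.
  by apply: hr; rewrite /t addrC addKr normrN gtr0_norm.
by rewrite ltr_norml => /andP[_ h]; lra.
Qed.

Section grid.
Variable eps : R.
Hypothesis eps0 : 0 < eps.

(* The level is [eps > 0] because the grids could skip the times at which the
   path is nonpositive, whereas they meet every neighbourhood of [hitting_time]. *)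
Definition grid_hit : set R :=
  [set t | (exists n i, t = i%:R * mesh R n) /\ f t <= eps].

Definition grid_hitting_time : R := inf grid_hit.

Let grid_hit_ge0 t : grid_hit t -> 0 <= t.
Proof. by move=> [[n [i ->]] _]; rewrite mulr_ge0// ltW// mesh_gt0. Qed.

Let grid_hit_le : exists2 t, grid_hit t & t <= hitting_time.
Proof.
have [r r0 hr] := continuous_dist hitting_time eps0.
have : \forall n \near \oo, mesh R n < r.
  move: cvg_mesh => /cvgrPdist_lt/(_ r r0); apply: filterS => n.
  by rewrite sub0r normrN gtr0_norm ?mesh_gt0.
move=> [n _ /(_ n (leqnn n)) nr]; have h0 := mesh_gt0 R n.
(* Rounding down, so that the grid point does not pass the hitting time. *)
pose i := Num.truncn (hitting_time / mesh R n).
have /andP[i1 i2] := truncn_itv (divr_ge0 T0_ge0 (ltW h0)).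
rewrite -/i ler_pdivlMr// in i1; rewrite -/i ltr_pdivrMr// in i2.
exists (i%:R * mesh R n) => //; split; first by exists n, i.
have : `|f (i%:R * mesh R n) - f hitting_time| < eps.
  apply: hr; rewrite ler0_norm ?subr_le0// opprB ltrBlDl.
  by apply: (lt_le_trans i2); rewrite -natr1 mulrDl mul1r lerD2l ltW.
by rewrite hitting_time_value subr0 => /ltW; apply: le_trans; exact: ler_norm.
Qed.

Let lbG : has_lbound grid_hit. Proof. by exists 0 => t /grid_hit_ge0. Qed.
Let G0 : grid_hit !=set0. Proof. by have [t] := grid_hit_le; exists t. Qed.

Lemma grid_hitting_time_ge0 : 0 <= grid_hitting_time.
Proof. by apply: lb_le_inf => // t /grid_hit_ge0. Qed.

Lemma grid_hitting_time_le : grid_hitting_time <= hitting_time.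
Proof. by have [t tG] := grid_hit_le; apply: le_trans; exact: ge_inf. Qed.

Lemma grid_hitting_time_ge s : (forall t, 0 <= t <= s -> eps < f t) ->
  s <= grid_hitting_time.
Proof.
move=> hs; apply: lb_le_inf => // t tG; rewrite leNgt; apply/negP => ts.
have := hs t; rewrite (grid_hit_ge0 tG) ltW// => /(_ isT).
by case: tG => _; rewrite leNgt => /negP.
Qed.

Lemma grid_stop_cvg :
  (stop (fun k => eps < f (k%:R * mesh R n)) (4 ^ n))%:R * mesh R n
    @[n --> \oo] --> grid_hitting_time.
Proof.
apply/cvgrPdist_lt => e e0.
have [t [[m [i ->]] fi] ti] := inf_adherent e0 (conj G0 lbG).
near=> n.
have mn : (m <= n)%N by near: n; exact: nbhs_infty_ge.
have ni : (i <= n)%N by near: n; exact: nbhs_infty_ge.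
pose j := (i * 2 ^ (n - m))%N.
have jE : j%:R * mesh R n = i%:R * mesh R m.
  rewrite /j /mesh -{2}(subnK mn) exprD natrM natrX -!mulrA; congr (_ * _).
  by rewrite invfM mulrA mulfV ?mul1r// expf_neq0.
(* Once [n] reaches [i], the near-optimal point lies below the cap on grid [n]. The stop is then a
   genuine hit, hence a member of [grid_hit] and not below its infimum. *)
have jN : (j < 4 ^ n)%N.
  rewrite /j -[4%N]/(2 ^ 2)%N -expnM mul2n -addnn expnD.
  apply: (@leq_ltn_trans (i * 2 ^ n)%N).
    by rewrite leq_mul2l leq_exp2l// leq_subr orbT.
  rewrite ltn_pmul2r ?expn_gt0//; apply: leq_ltn_trans ni _; exact: ltn_expl.
set b := fun k => _; set st := stop _ _.
have stj : (st <= j)%N by apply: stop_leq; rewrite /b jE -leNgt.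
have hit : f (st%:R * mesh R n) <= eps.
  have := @stop_hit b (4 ^ n)%N (leq_ltn_trans stj jN).
  by rewrite /b -leNgt.
have lo : grid_hitting_time <= st%:R * mesh R n.
  by apply: ge_inf => //; split => //; exists n, st.
rewrite ler0_norm ?subr_le0// opprB ltrBlDl; apply: le_lt_trans ti.
by rewrite -jE ler_pM2r ?mesh_gt0// ler_nat.
Unshelve. all: by end_near. Qed.

End grid.

(** Up to [e / 2] before the hitting time the path has a positive minimum [m], so a level below [m]
    cannot be reached that early. *)
Lemma grid_hitting_time_cvg :
  grid_hitting_time (harmonic j) @[j --> \oo] --> hitting_time.
Proof.
apply/cvgrPdist_lt => e e0; have e2 : 0 < e / 2 by rewrite divr_gt0.
have [m m0 hm] : exists2 m, 0 < m & forall t, 0 <= t <= hitting_time - e / 2 -> m <= f t.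
  have [neg|pos] := ltP (hitting_time - e / 2) 0.
    by exists 1 => // t /andP[t0 /(le_trans t0)]; rewrite leNgt neg.
  have [z + hz] := EVT_min pos (continuous_subspaceT cf).
  rewrite in_itv/= => /andP[z0 zT]; exists (f z).
    by apply: before_hitting_time; rewrite z0/=; lra.
  by move=> t tI; apply: hz; rewrite in_itv.
have := @cvg_harmonic R => /cvgrPdist_lt/(_ m m0); apply: filterS => j.
rewrite sub0r normrN gtr0_norm ?harmonic_gt0// => jm.
have h1 := grid_hitting_time_le (harmonic_gt0 j).
have h2 : hitting_time - e / 2 <= grid_hitting_time (harmonic j).
  apply: grid_hitting_time_ge (harmonic_gt0 j) _ _ => t /hm.
  exact: lt_le_trans.
rewrite ger0_norm ?subr_ge0//; lra.
Qed.

End hitting.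
End continuous_path.

(** * Integrals off a null set *)

Section off_null_set.
Context d (T : measurableType d) (R : realType).
Variable m : {measure set T -> \bar R}.
Variable N : set T.
Hypotheses (mN : measurable N) (N0 : m N = 0%E).

Import HBNNSimple.

(* No function is assumed measurable: [P] need not be complete, so the first
   passage time is only almost everywhere equal to a measurable function. *)
Lemma ge0_le_integral_off_null (f g : T -> \bar R) :
  (forall w, 0 <= f w)%E -> (forall w, 0 <= g w)%E ->
  (forall w, ~ N w -> (f w <= g w)%E) ->
  (\int[m]_w f w <= \int[m]_w g w)%E.
Proof.
move=> f0 g0 fg; rewrite !ge0_integralTE//; apply: ge_ereal_sup => _ [h /= hf <-].
have mNc : measurable (~` N) by exact: measurableC.
(* Cutting a simple function below [f] to zero on [N] puts it below [g] without changing its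
   integral. *)
apply: ereal_sup_ubound; exists (proj_nnsfun h mNc) => /=.
  move=> w; rewrite /proj_nnsfun /= /mindic indicE.
  have [wN|wN] := pselect (N w).
    by rewrite memNset ?mulr0//; exact.
  by rewrite mem_set// mulr1 (le_trans (hf w))// fg.
rewrite -!integralT_nnsfun; apply: ge0_ae_eq_integral => //.
- by apply/measurable_EFinP.
- by apply/measurable_EFinP.
- by move=> w _; rewrite lee_fin.
- by move=> w _; rewrite lee_fin.
exists N; split => // w /= h1; apply: contrapT => wN; apply: h1 => _.
by rewrite /mindic indicE mem_set ?mulr1.
Qed.

Lemma integral_eq_off_null (f g : T -> \bar R) :
  (forall w, ~ N w -> f w = g w) -> (\int[m]_w f w = \int[m]_w g w)%E.
Proof.
move=> fg; rewrite integralE [RHS]integralE; congr (_ - _)%E;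
  apply/eqP; rewrite eq_le; apply/andP; split; apply: ge0_le_integral_off_null => //
  w wN; by rewrite ?funeposE ?funenegE fg.
Qed.

(** The measurable version [f'] is [f] set to zero on [N]; it is the everywhere limit of the
    functions [f_ n] cut in the same way. *)
Lemma dominated_convergence_off_null (f_ : nat -> T -> R) (f : T -> R) (g : T -> \bar R) :
  (forall n, measurable_fun setT (f_ n)) ->
  (forall w, ~ N w -> f_ n w @[n --> \oo] --> f w) ->
  m.-integrable setT g ->
  (forall n w, ~ N w -> (`|f_ n w|%:E <= g w)%E) ->
  exists f', [/\ measurable_fun setT f', forall w, ~ N w -> f' w = f w,
     m.-integrable setT (EFin \o f') &
     (\int[m]_w (f_ n w)%:E @[n --> \oo] --> \int[m]_w (f' w)%:E)%E].
Proof.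
move=> mf ff ig fg; have mNc : measurable (~` N) by exact: measurableC.
pose f' w := f w * \1_(~` N) w.
have cvgf w : f_ n w * \1_(~` N) w @[n --> \oo] --> f' w.
  rewrite /f' indicE; have [wN|wN] := pselect (N w).
    by rewrite memNset /= ?mulr0; [under eq_fun do rewrite mulr0; exact: cvg_cst|exact].
  by rewrite mem_set// mulr1; under eq_fun do rewrite mulr1; exact: ff.
have mf' : measurable_fun setT f'.
  apply: (measurable_fun_cvg (h := fun n w => f_ n w * \1_(~` N) w)) => //.
  by move=> n; apply: measurable_funM => //; exact: measurable_indic.
exists f'; have Ef' w : ~ N w -> f' w = f w.
  by move=> wN; rewrite /f' indicE mem_set// mulr1.
have [] := @dominated_convergence _ _ _ m setT measurableT
  (fun n => EFin \o f_ n) (EFin \o f') g.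
- by move=> n; exact/measurable_EFinP.
- exact/measurable_EFinP.
- exists N; split => // w /= h1; apply: contrapT => wN; apply: h1 => _.
  rewrite Ef'//; apply: cvg_EFin; first exact: nearW.
  exact: ff.
- exact: ig.
- exists N; split => // w /= h1; apply: contrapT => wN; apply: h1 => n _.
  exact: fg.
by move=> if' _ cf'; split.
Qed.

End off_null_set.

(** * Primitives of continuous functions *)

Section primitive_existence.
Context {R : realType} (f : R -> R) (cf : continuous f).
Local Notation mu := (@lebesgue_measure R).

Lemma primitive_exists : exists G : R -> R, [/\ G 0 = 0,
  forall t : R, 0 <= t -> is_derive t 1 G (f t) &
  forall t : R, 0 <= t -> \int[mu]_(u in `[0, t]) f u = G t].
Proof.
(* Starting at -1 makes 0 an interior point, so that the derivative at 0 is two-sided. *)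
pose H t := \int[mu]_(u in `[-1, t]) f u.
have fi a b : mu.-integrable `[a, b] (EFin \o f).
  apply: continuous_compact_integrable; first exact: segment_compact.
  exact: continuous_subspaceT.
exists (fun t => H t - H 0); split; first by rewrite subrr.
  move=> t t0.
  have t1 : t < t + 1 by rewrite ltrDl.
  have m1 : -1 < t by apply: lt_le_trans t0.
  have [dH EH] := continuous_FTC1_closed t1 (fi (-1) (t + 1)) m1 (@cf t).
  have dH' : is_derive t 1 H (f t).
    by rewrite -EH derive1E; exact: DeriveDef.
  rewrite -[f t]subr0.
  by apply: is_deriveB.
move=> t t0; rewrite /H.
rewrite (@Rintegral_itvB _ f (BLeft (-1)) (BRight t) 0) ?bnd_simp//.
rewrite Rintegral_itv_obnd_cbnd//.
by apply: integrableS (fi 0 t) => //; exact: subset_itv_oc_cc.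
Qed.

End primitive_existence.

(** * Passage to the limit *)

Lemma functional_cvg (R : realType) (cf : nat -> R) (q : nat -> R -> R)
    (h_ t_ y_ a_ : nat -> R) (h t y a : R) :
  (forall i, {for h, continuous (q i)}) -> h_ n @[n --> \oo] --> h ->
  t_ n @[n --> \oo] --> t -> y_ n @[n --> \oo] --> y -> a_ n @[n --> \oo] --> a ->
  functional cf q (h_ n) (t_ n) (y_ n) (a_ n) @[n --> \oo] --> functional cf q h t y a.
Proof.
move=> cq hh ht hy ha.
have hq i : q i (h_ n) @[n --> \oo] --> q i h by apply: continuous_cvg => //; exact: cq.
have cX (u : nat -> R) (l : R) k : u n @[n --> \oo] --> l -> u n ^+ k @[n --> \oo] --> l ^+ k.
  move=> hu; elim: k => [|k IH]; first by under eq_fun do rewrite expr0; exact: cvg_cst.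
  by under eq_fun do rewrite exprS; rewrite exprS; exact: cvgM.
have cD (u v : nat -> R) (l l' : R) : u n @[n --> \oo] --> l ->
    v n @[n --> \oo] --> l' -> u n + v n @[n --> \oo] --> l + l' by exact: cvgD.
have cM (u v : nat -> R) (l l' : R) : u n @[n --> \oo] --> l ->
    v n @[n --> \oo] --> l' -> u n * v n @[n --> \oo] --> l * l' by exact: cvgM.
have cC i : cf i @[n --> \oo] --> cf i by exact: cvg_cst.
have lin i j k := cD _ _ _ _ (cD _ _ _ _ (hq i) (cM _ _ _ _ (hq j) ht))
  (cM _ _ _ _ (hq k) ha).
rewrite /functional; apply: (cD); [apply: (cD); [apply: (cD); [apply: (cD)|]|]|].
- exact: cM (hq 0) (cX _ _ 4 hy).
- exact: cM (hq 1) (cX _ _ 3 hy).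
- exact: cM (lin 2 3 4) (cX _ _ 2 hy).
- exact: cM (lin 5 6 7) hy.
- exact: cD (cD _ _ _ _ (cD _ _ _ _ (cD _ _ _ _ (cM _ _ _ _ (cC 0) ht)
    (cM _ _ _ _ (cC 1) ha)) (cM _ _ _ _ (cC 2) (cX _ _ 2 ht)))
    (cM _ _ _ _ (cC 3) (cM _ _ _ _ ht ha))) (cM _ _ _ _ (cC 4) (cX _ _ 2 ha)).
Qed.

Section first_passage.
Context d (T : measurableType d) (R : realType) (P : probability T R).
Variable B : R -> {RV P >-> R}.
Hypothesis hB : standard_brownian_motion B.
Variables (x mu : R).
Hypotheses (x0 : 0 < x) (mu0 : 0 < mu).

Let c : R := mu / 2.
Let c0 : 0 < c. Proof. by rewrite divr_gt0. Qed.

Section uniform_bound.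
Variables (cf : nat -> R) (q : nat -> R -> R).
Hypothesis cq : forall i, continuous (q i).

(** Grid, level, path and bound: with all four in the point, one constant serves both limits. *)
Let Z : Type := (nat * R * T * R)%type.
Let Q (z : Z) : Prop := 0 <= z.1.1.2 /\ path_bound B c z.1.1.1 (z.1.2, z.2).
Let st (z : Z) : nat := stop_index B x mu z.1.1.2 z.1.1.1 z.1.2.
Let h (z : Z) : R := mesh R z.1.1.1.
Let Q0 z : Q z -> 0 <= z.2. Proof. by move=> [_ []]. Qed.

Let mesh_le1 n : mesh R n <= 1.
Proof. by rewrite /mesh invf_le1 ?exprn_gt0// exprn_ege1// ler1n. Qed.

(** While the path is alive at time t, 0 < x - mu t + K + mu t / 2, so t < 2 (x + K) / mu. The stop
    is at most one step later, and steps have length at most 1. *)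
Let Ct : R := 2 * (x + 1) / mu + 1.
Let Ct0 : 0 < Ct.
Proof. by rewrite addr_gt0// divr_gt0// mulr_gt0// addr_gt0. Qed.

Let stop_time_le z : Q z -> (st z)%:R * h z <= Ct * (1 + z.2).
Proof.
move: z => [[[n e] w] K] [/= e0 [/= K0 hK]].
have [m0|] := posnP (st (n, e, w, K)).
  by rewrite m0 mul0r mulr_ge0 ?(ltW Ct0)// addr_ge0.
case E : (st (n, e, w, K)) => [//|j] _.
have jst : (j < st (n, e, w, K))%N by rewrite E.
have jN : (j <= 4 ^ n)%N by apply: ltnW; apply: leq_trans jst _; exact: stop_le.
have /= := lt_stop jst; rewrite /grid_pos walk_increment /h/=.
have := hK j jN; rewrite ler_norml => /andP[_].
rewrite -natr1 mulrDl mul1r.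
move: (B _ w - B 0 w) (mesh_le1 n) => b; move: (mesh R n) (j%:R * mesh R n) => m t.
rewrite /c /Ct => m1 hb ht.
have : t <= 2 * (x + K) / mu by rewrite ler_pdivlMr//; lra.
have : 0 <= 2 * x * K / mu by rewrite divr_ge0 ?mulr_ge0 ?(ltW x0) ?(ltW mu0).
have -> : (2 * (x + 1) / mu + 1) * (1 + K) =
  2 * (x + K) / mu + 1 + 2 * x * K / mu + 2 / mu + K by field; rewrite gt_eqF.
have : 0 < 2 / mu by rewrite divr_gt0.
lra.
Qed.

Let Cy : R := x + 1 + (mu + c) * Ct.
Let Cy0 : 0 < Cy.
Proof. by rewrite addr_gt0 ?addr_gt0// mulr_gt0// addr_gt0. Qed.

Let grid_pos_le z j : Q z -> (j <= st z)%N ->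
  `|grid_pos B x mu (h z) j z.1.2| <= Cy * (1 + z.2).
Proof.
move=> Qz jst; have := stop_time_le Qz.
have jN : (j <= 4 ^ z.1.1.1)%N by apply: leq_trans jst _; exact: stop_le.
have hm : j%:R * h z <= (st z)%:R * h z.
  by rewrite ler_wpM2r ?ler_nat// ltW// mesh_gt0.
have t0 : 0 <= j%:R * h z by rewrite mulr_ge0// ltW// mesh_gt0.
move=> /(le_trans hm); rewrite /grid_pos walk_increment.
case: Qz => _ [K0 /(_ j jN)] /=; rewrite -/(h z).
move: (B _ _ - B 0 _) => b; move: (z.2) (j%:R * h z) K0 t0 => K t K0 t0 hb ht.
rewrite /Cy; apply: (le_trans (ler_normD _ _)).
apply: (@le_trans _ _ (x + mu * t + (K + c * t))).
  rewrite lerD//; apply: (le_trans (ler_normB _ _)).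
  by rewrite (gtr0_norm x0) normrM (gtr0_norm mu0) (ger0_norm t0).
have : (mu + c) * t <= (mu + c) * (Ct * (1 + K)).
  by rewrite ler_wpM2l// addr_ge0 ?(ltW mu0) ?(ltW c0).
have : 0 <= x * K by rewrite mulr_ge0// ltW.
lra.
Qed.

Lemma growth_stopped_functional : growth Q snd 4
  (fun z => stopped_functional B x mu cf q z.1.1.2 z.1.1.1 z.1.2).
Proof.
apply: (@growth_functional _ cf q Z Q snd h (fun z => (st z)%:R * h z)
  (fun z => grid_pos B x mu (h z) (st z) z.1.2)
  (fun z => grid_area B x mu (h z) (st z) z.1.2) Q0).
- move=> i; have ci : continuous (fun v => `|q i v|).
    by move=> v; apply: cvg_norm; exact: cq.
  have [v _ hv] := EVT_max ler01 (continuous_subspaceT ci).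
  exists `|q i v| => // z _; rewrite expr0 mulr1; apply: hv.
  by rewrite in_itv/= mesh_le1 ltW// mesh_gt0.
- exists Ct; first exact: ltW.
  move=> z Qz; rewrite expr1 ger0_norm ?stop_time_le//.
  by rewrite mulr_ge0// ltW// mesh_gt0.
- exists Cy; first exact: ltW.
  by move=> z Qz; rewrite expr1; exact: grid_pos_le.
(* Height times duration, each linear in 1 + K, so the area takes exponent 2. *)
- exists (Ct * Cy); first by rewrite mulr_ge0// ltW.
  move=> z Qz; have h0 : 0 < h z := mesh_gt0 R z.1.1.1.
  apply: (le_trans (ler_norm_sum _ _ _)).
  apply: (@le_trans _ _ (\sum_(j < st z) h z * (Cy * (1 + z.2)))).
    apply: ler_sum => j _; rewrite normrM gtr0_norm// ler_wpM2l ?(ltW h0)//.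
    by apply: grid_pos_le => //; exact: ltnW.
  rewrite sumr_const card_ord -mulr_natl mulrA expr2 mulrACA.
  rewrite (mulrC _ (1 + z.2)) ?mulrA.
  have Cy1 : 0 <= Cy * (1 + z.2) by apply: mulr_ge0; [exact: ltW|rewrite addr_ge0 ?(Q0 Qz)].
  have := ler_wpM2r Cy1 (stop_time_le Qz); lra.
Qed.

End uniform_bound.
End first_passage.

Lemma within_continuous_comp_max (R : realType) (g : R -> R) :
  {within `[0, +oo[, continuous g} -> continuous (fun t : R => g (Num.max t 0)).
Proof.
move=> /subspace_continuousP cg t.
have m0 (s : R) : `[0, +oo[%classic (Num.max s 0).
  by rewrite /= in_itv/= andbT le_max lexx orbT.
have cm : Num.max s 0 @[s --> t] --> Num.max t 0.

  by apply: (@continuous_max _ _ (fun s : R => s) (fun=> 0)); [exact: cvg_id|exact: cvg_cst].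
apply: (cvg_comp (fun s : R => Num.max s 0) g _ (cg _ (m0 t))) => U; rewrite /within /= => hU.
apply: (@filterS _ (nbhs t) _ _ _ _ (cm _ hU)) => s /=; apply; exact: m0.
Qed.

Section first_passage_limit.
Context d (T : measurableType d) (R : realType) (P : probability T R).
Variable B : R -> {RV P >-> R}.
Hypothesis hB : standard_brownian_motion B.
Variables (x mu : R).
Hypotheses (x0 : 0 < x) (mu0 : 0 < mu).

Let c : R := mu / 2.
Let c0 : 0 < c. Proof. by rewrite divr_gt0. Qed.

Definition regular_path (w : T) : Prop :=
  [/\ B 0 w = 0, {within `[0, +oo[, continuous (fun t : R => B t w)} &
    (envelope B c w < +oo)%E].

Lemma regular_path_ae : exists N, [/\ measurable N, P N = 0%E &
  forall w, ~ N w -> regular_path w].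
Proof.
have [N1 [mN1 N10 h1]] := sbm_start hB.
have [N2 [mN2 N20 h2]] := sbm_continuous_paths hB.
have [N3 [mN3 N30 h3]] := integrable_ae measurableT (envelope_integrable hB c0).
exists (N1 `|` N2 `|` N3); split.
- by do ! apply: measurableU.
- by rewrite !null_set_setU//; exact: measurableU.
- move=> w hw; split.
  + by apply: contrapT => hw'; apply: hw; left; left; apply: h1.
  + by apply: contrapT => hw'; apply: hw; left; right; apply: h2.
  + have : envelope B c w \is a fin_num.
      apply: contrapT => hw'; apply: hw; right; apply: h3 => /= h; apply: hw'.
      exact: h.
    by rewrite ltey_eq => ->.
Qed.

(* Frozen at negative times, where [B] is unconstrained. *)
Definition drift_path (w : T) (t : R) : R := x - mu * Num.max t 0 + B (Num.max t 0) w.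

Lemma path_drifted w t : 0 <= t -> drift_path w t = drifted B mu x t w.
Proof. by move=> t0; rewrite /drift_path max_l. Qed.

Section regular.
Variable w : T.
Hypothesis reg : regular_path w.

Lemma path_continuous : continuous (drift_path w).
Proof.
have [_ cB _] := reg; move=> t; apply: cvgD.
  apply: cvgD; first exact: cvg_cst.
  apply: cvgN; apply: cvgM; first exact: cvg_cst.
  apply: (within_continuous_comp_max (g := id)).
  by apply: continuous_subspaceT => s; exact: cvg_id.
exact: (within_continuous_comp_max cB).
Qed.

Lemma path0 : drift_path w 0 = x.
Proof. by have [h _ _] := reg; rewrite /drift_path max_l// h mulr0 subr0 addr0. Qed.

Lemma path_gt0 : 0 < drift_path w 0. Proof. by rewrite path0. Qed.

Lemma grid_posE n k : grid_pos B x mu (mesh R n) k w = drift_path w (k%:R * mesh R n).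
Proof.
have [h _ _] := reg; have t0 : 0 <= k%:R * mesh R n by rewrite mulr_ge0// ltW// mesh_gt0.
by rewrite /grid_pos walk_increment h subr0 /drift_path max_l.
Qed.

(** The bound on the path holds at grid points within the horizon only. An integer time k is such a
    point of the grid with mesh 2^-k, at index k 2^k <= 4^k, and past 2 (x + K) / mu the path is
    nonpositive there. *)
Lemma path_le0 : exists2 t, 0 < t & drift_path w t <= 0.
Proof.
have [h _ /(envelope_bound c0)[K K0 [_ hK]]] := reg.
have [k kP] : exists k, 2 * (x + K) / mu < k%:R.
  by exists (Num.truncn (2 * (x + K) / mu)).+1; exact: truncnS_gt.
have kN : (k * 2 ^ k <= 4 ^ k)%N.
  have -> : (4 ^ k = 2 ^ k * 2 ^ k)%N by rewrite -expnMn.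
  by apply: leq_mul => //; apply: ltnW; exact: ltn_expl.
have := hK k (k * 2 ^ k)%N.
have -> : (k * 2 ^ k)%:R * mesh R k = k%:R.
  by rewrite /mesh natrM natrX mulfK// expf_neq0.
move=> /(_ kN); rewrite h subr0 ler_norml => /andP[_ hk].
exists k%:R.
  by apply: le_lt_trans kP; rewrite divr_ge0 ?(ltW mu0)// mulr_ge0// addr_ge0// ltW.
rewrite /drift_path max_l//; move: hk kP; rewrite ltr_pdivrMr// /c.
move: (B _ w) => b; lra.
Qed.

Definition hit : R := hitting_time (drift_path w).

Lemma first_passage_timeE : first_passage_time (drifted B mu x) w = hit%:E.
Proof.
rewrite -(hitting_time_ereal path_le0); congr (ereal_inf _).
by apply/seteqP; split => _ [t [t0 ht] <-]; exists t => //; split => //;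
  move: ht; rewrite path_drifted// ltW.
Qed.

Lemma hit_gt0 : 0 < hit.
Proof. exact: hitting_time_gt0 path_continuous path_gt0 path_le0. Qed.

Lemma first_passage_areaE : first_passage_area (drifted B mu x) w =
  \int[lebesgue_measure]_(t in `[0, hit]) drift_path w t.
Proof.
rewrite /first_passage_area first_passage_timeE.
have -> : [set t | 0 <= t /\ (t%:E <= hit%:E)%E] = `[0, hit]%classic.
  by apply/seteqP; split => t /=; rewrite in_itv/= lee_fin; [case=> -> ->|move/andP].
apply: eq_Rintegral => t; rewrite inE/= in_itv/= => /andP[t0 _].
by rewrite path_drifted.
Qed.

End regular.

Variables (cf : nat -> R) (q : nat -> R -> R).
Hypothesis cq : forall i, continuous (q i).
Hypothesis mart : is_discrete_martingale cf q mu.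

Definition limit_functional (w : T) (s : R) : R :=
  functional cf q 0 s (drift_path w s) (\int[lebesgue_measure]_(t in `[0, s]) drift_path w t).

Lemma stopped_functional_cvg w eps : regular_path w -> 0 < eps ->
  stopped_functional B x mu cf q eps n w @[n --> \oo] -->
  limit_functional w (grid_hitting_time (drift_path w) eps).
Proof.
move=> reg e0; have cp := path_continuous reg.
have [G [G0 dG EG]] := primitive_exists cp.
have s0 : 0 <= grid_hitting_time (drift_path w) eps.
  exact: (grid_hitting_time_ge0 cp (path_gt0 reg) (path_le0 reg) e0).
have hs : (stop_index B x mu eps n w)%:R * mesh R n @[n --> \oo] -->
    grid_hitting_time (drift_path w) eps.
  have := grid_stop_cvg cp (path_gt0 reg) (path_le0 reg) e0.
  apply: cvg_trans; apply: near_eq_cvg; near=> n; congr (_%:R * _).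
  by congr stop; apply/funext => k; rewrite grid_posE.
rewrite /stopped_functional /limit_functional EG//; apply: functional_cvg => //.
- by move=> i; exact: cq.
- exact: cvg_mesh.
- under eq_fun do rewrite grid_posE//; apply: continuous_cvg => //; exact: cp.
- have := riemann_cvg cp G0 dG s0 hs.
  apply: cvg_trans; apply: near_eq_cvg; near=> n; rewrite /grid_area.
  by apply: eq_bigr => j _; rewrite grid_posE.
Unshelve. all: by end_near. Qed.

Lemma limit_functional_cvg w : regular_path w ->
  limit_functional w (grid_hitting_time (drift_path w) (harmonic j)) @[j --> \oo] -->
  limit_functional w (hit w).
Proof.
move=> reg; have cp := path_continuous reg.
have [G [G0 dG EG]] := primitive_exists cp.
have s0 j : 0 <= grid_hitting_time (drift_path w) (harmonic j).
  exact: (grid_hitting_time_ge0 cp (path_gt0 reg) (path_le0 reg) (harmonic_gt0 j)).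
have hs := grid_hitting_time_cvg cp (path_gt0 reg) (path_le0 reg).
rewrite /limit_functional; apply: functional_cvg => //.
- by move=> i; exact: cq.
- exact: cvg_cst.
- by apply: continuous_cvg => //; exact: cp.
- under eq_fun do rewrite EG//; rewrite EG ?(ltW (hit_gt0 reg))//.
  by apply: continuous_cvg => //; exact: primitive_continuous dG _ (ltW (hit_gt0 reg)).
Qed.

Lemma limit_functional_hit w : regular_path w -> limit_functional w (hit w) =
  cf 0 * hit w + cf 1 * first_passage_area (drifted B mu x) w + cf 2 * hit w ^+ 2 +
  cf 3 * (hit w * first_passage_area (drifted B mu x) w) +
  cf 4 * first_passage_area (drifted B mu x) w ^+ 2.
Proof.
move=> reg; rewrite /limit_functional first_passage_areaE//.
have -> : drift_path w (hit w) = 0.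
  exact: hitting_time_value (path_continuous reg) (path_gt0 reg) (path_le0 reg).
rewrite /functional; ring.
Qed.

Lemma stopped_functional_bound : exists C, forall n eps w, 0 < eps -> regular_path w ->
  (`|stopped_functional B x mu cf q eps n w|%:E <= C%:E * envelope B c w)%E.
Proof.
have [C C0 hC] := @growth_stopped_functional _ _ _ _ B x mu x0 mu0 cf q cq.
exists C => n eps w e0 [_ _ fin].
have [K K0 [hK hBK]] := envelope_bound c0 fin.
apply: (@le_trans _ _ (C%:E * ((1 + K) ^+ 4)%:E)%E); last by rewrite lee_wpmul2l.
rewrite -EFinM lee_fin; apply: (hC (n, eps, w, K)); split; first exact: ltW.
by split => //; exact: hBK.
Qed.

(** [Y] is a measurable version of the functional at the hitting time, where the position is zero
    and only the polynomial in tau and A survives. *)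
Theorem first_passage_moment : exists Y : T -> R, exists N,
  [/\ measurable N, P N = 0%E, P.-integrable setT (EFin \o Y),
    forall w, ~ N w -> regular_path w /\ Y w = limit_functional w (hit w) &
    (\int[P]_w (Y w)%:E = (functional cf q 0 0 x 0)%:E)%E].
Proof.
have [N [mN N0 reg]] := regular_path_ae; have [C hC] := stopped_functional_bound.
have ig : P.-integrable setT (fun w => C%:E * envelope B c w)%E.
  by apply: integrableZl => //; exact: envelope_integrable.
(* Limit over the grids at a fixed level. The means converge to the value at [h = 0], which does not
   involve the level, so in the second limit they are constant. *)
have step1 j : exists f', [/\ measurable_fun setT f',
    forall w, ~ N w -> f' w = limit_functional w (grid_hitting_time (drift_path w) (harmonic j)),
    P.-integrable setT (EFin \o f') &
    (\int[P]_w (f' w)%:E = (functional cf q 0 0 x 0)%:E)%E].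
  have mf n : measurable_fun setT (stopped_functional B x mu cf q (harmonic j) n).
    apply/measurable_EFinP.
    by have [/measurable_int] := integral_stopped_functional hB x c0 mart (harmonic j) n.
  have [|f' [mf' Ef' if' cf']] := dominated_convergence_off_null mN N0 mf
    (fun w wN => stopped_functional_cvg (reg w wN) (harmonic_gt0 j)) ig.
    by move=> n w wN; apply: hC; [exact: harmonic_gt0|exact: reg].
  exists f'; split => //.
  apply: cvg_unique cf' _ => //.
  rewrite (_ : (fun n => _) = fun n => (functional cf q (mesh R n) 0 x 0)%:E); last first.
    by apply/funext => n; exact: (integral_stopped_functional hB x c0 mart _ _).2.
  apply: cvg_EFin; first exact: nearW.
  apply: functional_cvg; try exact: cvg_cst.
    by move=> i; exact: cq.
  exact: cvg_mesh.
have /choice[F hF] := step1.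
have mF j : measurable_fun setT (F j) by have [] := hF j.
have cF w : ~ N w -> F j w @[j --> \oo] --> limit_functional w (hit w).
  move=> wN; under eq_fun do rewrite (let: And4 _ h _ _ := hF _ in h w wN).
  exact: limit_functional_cvg (reg w wN).
(* The majorant of the stopped functionals passes to their limits and is reused for the second
   domination. *)
have bF j w : ~ N w -> (`|F j w|%:E <= C%:E * envelope B c w)%E.
  move=> wN.
  have [_ -> // _ _] := hF j; have cw := stopped_functional_cvg (reg w wN) (harmonic_gt0 j).
  have h n : (`|stopped_functional B x mu cf q (harmonic j) n w|%:E <= C%:E * envelope B c w)%E.
    by apply: hC; [exact: harmonic_gt0|exact: reg].
  have := h 0%N; have := h; case: (C%:E * _)%E => [r||] // hr _; last by rewrite leey.
  rewrite lee_fin; apply: cvgr_to_le (cvg_norm cw) _.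
  by apply: nearW => n; rewrite -lee_fin.
have [Y [mY EY iY cY]] := dominated_convergence_off_null mN N0 mF cF ig bF.
exists Y, N; split => //; first by move=> w wN; split; [exact: reg|exact: EY].
apply: cvg_unique cY _ => //.
rewrite (_ : (fun j => _) = fun=> (functional cf q 0 0 x 0)%:E); first exact: cvg_cst.
by apply/funext => j; have [] := hF j.
Qed.

End first_passage_limit.

(** * The five moments and the correlation *)

(* Obtained by comparing coefficients in [is_discrete_martingale], which gives a
   triangular linear system. *)
Definition moment_coef (R : realType) (mu : R) (cf : nat -> R) (i : nat) (h : R) : R :=
  nth 0 [::
    cf 4 * (4 * mu ^+ 2)^-1;
    cf 3 * (2 * mu ^+ 2)^-1 + cf 4 * (h * (2 * mu)^-1 + 5 * (6 * mu ^+ 3)^-1);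
    cf 1 * (2 * mu)^-1 + cf 2 * (mu ^+ 2)^-1 +
      cf 3 * (h * (2 * mu)^-1 + (mu ^+ 3)^-1) +
      cf 4 * (h * h * 4^-1 + h * (2 * mu ^+ 2)^-1 + 5 * (4 * mu ^+ 4)^-1);
    cf 3 * (2 * mu)^-1;
    cf 4 * mu^-1;
    cf 0 * mu^-1 + cf 1 * (h * 2^-1 + (2 * mu ^+ 2)^-1) + cf 2 * (mu ^+ 3)^-1 +
      cf 3 * (mu ^+ 4)^-1 +
      cf 4 * (5 * (4 * mu ^+ 5)^-1 - h * h * (12 * mu)^-1);
    cf 2 * (2 * mu^-1) + cf 3 * (h * 2^-1 + (2 * mu ^+ 2)^-1);
    cf 3 * mu^-1 + cf 4 * (h + (mu ^+ 2)^-1)] i.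

Lemma moment_coef_martingale (R : realType) (mu : R) (cf : nat -> R) : 0 < mu ->
  is_discrete_martingale cf (moment_coef mu cf) mu.
Proof.
move=> mu0 h t y a h0; rewrite /functional /fcoef2 /moment_coef /=.
by field; rewrite gt_eqF.
Qed.

Lemma moment_coef_continuous (R : realType) (mu : R) (cf : nat -> R) i :
  continuous (moment_coef mu cf i).
Proof.
move=> h; rewrite /moment_coef.
have cC (r : R) : r @[_ --> h] --> r by exact: cvg_cst.
have ch : h' @[h' --> h] --> h by exact: cvg_id.
have cD (u v : R -> R) (l l' : R) : u h' @[h' --> h] --> l ->
    v h' @[h' --> h] --> l' -> u h' + v h' @[h' --> h] --> l + l' by exact: cvgD.
have cM (u v : R -> R) (l l' : R) : u h' @[h' --> h] --> l ->
    v h' @[h' --> h] --> l' -> u h' * v h' @[h' --> h] --> l * l' by exact: cvgM.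
have cN (u : R -> R) (l : R) : u h' @[h' --> h] --> l ->
    - u h' @[h' --> h] --> - l by exact: cvgN.
by do 8 (case: i => [|i] /=; [by do ! first [exact: cC | exact: ch | apply: (cD) |
  apply: (cM) | apply: (cN)] | ]); rewrite nth_nil; exact: cC.
Qed.

Section correlation_first_passage.
Context d (T : measurableType d) (R : realType) (P : probability T R).
Variable B : R -> {RV P >-> R}.
Hypothesis hB : standard_brownian_motion B.
Variables (x mu : R).
Hypotheses (x0 : 0 < x) (mu0 : 0 < mu).

Let tau (w : T) : R := fine (first_passage_time (drifted B mu x) w).
Let A : T -> R := first_passage_area (drifted B mu x).

(** These five values are [functional] at h = 0, t = 0, y = x, a = 0, with [cf] the successive unit
    vectors. *)
Definition moment_tau : R := x / mu.
Definition moment_A : R := x ^+ 2 / (2 * mu) + x / (2 * mu ^+ 2).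
Definition moment_tau2 : R := x ^+ 2 / mu ^+ 2 + x / mu ^+ 3.
Definition moment_tauA : R := x ^+ 3 / (2 * mu ^+ 2) + x ^+ 2 / mu ^+ 3 + x / mu ^+ 4.
Definition moment_A2 : R := x ^+ 4 / (4 * mu ^+ 2) + 5 * x ^+ 3 / (6 * mu ^+ 3) +
  5 * x ^+ 2 / (4 * mu ^+ 4) + 5 * x / (4 * mu ^+ 5).

(** The constant [k] lets centred squares such as (tau - m)^2 be integrated in one go, so a variance
    is an instance with coefficients m^2, - 2 m and 1. *)
Lemma expectation_quadratic (k k0 k1 k2 k3 k4 : R) :
  ('E_P[(fun w => k + (k0 * tau w + k1 * A w + k2 * tau w ^+ 2 + k3 * (tau w * A w) +
    k4 * A w ^+ 2))%R] = (k + (k0 * moment_tau + k1 * moment_A + k2 * moment_tau2 +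
    k3 * moment_tauA + k4 * moment_A2))%:E)%E.
Proof.
pose cf i := nth 0 [:: k0; k1; k2; k3; k4] i.
have [Y [N [mN N0 iY YE EY]]] := first_passage_moment hB x0 mu0
  (@moment_coef_continuous R mu cf) (moment_coef_martingale cf mu0).
rewrite unlock.
rewrite (integral_eq_off_null mN N0 (g := fun w => (cst k%:E w + (Y w)%:E)%E)); last first.
  move=> w /YE[reg ->]; rewrite limit_functional_hit// -EFinD; congr (_ + _)%:E.
  by rewrite /tau (first_passage_timeE x0 mu0 reg).
rewrite integralD//; last exact: finite_measure_integrable_cst.
have -> : (\int[P]_w cst k%:E w = k%:E)%E.
  by rewrite integral_cst// -[RHS]mule1; congr (_ * _)%E; exact: probability_setT.
rewrite EY -EFinD; congr (_ + _)%:E.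
rewrite /functional /moment_coef /cf /= /moment_tau /moment_A /moment_tau2 /moment_tauA /moment_A2.
by field; rewrite gt_eqF.
Qed.

Let E_ (f : T -> R) (r : R) : ('E_P[f] = r%:E)%E -> fine 'E_P[f] = r.
Proof. by move=> ->. Qed.

Lemma expectation_tau : ('E_P[tau] = moment_tau%:E)%E.
Proof.
have := expectation_quadratic 0 1 0 0 0 0; rewrite !mul0r mul1r !addr0 add0r => <-.
by congr expectation; apply/funext => w; ring.
Qed.

Lemma expectation_A : ('E_P[A] = moment_A%:E)%E.
Proof.
have := expectation_quadratic 0 0 1 0 0 0; rewrite !mul0r mul1r !addr0 !add0r => <-.
by congr expectation; apply/funext => w; ring.
Qed.

Lemma expectation_tauA : ('E_P[tau \* A] = moment_tauA%:E)%E.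
Proof.
have := expectation_quadratic 0 0 0 0 1 0; rewrite !mul0r mul1r !addr0 !add0r => <-.
by congr expectation; apply/funext => w /=; ring.
Qed.

Lemma variance_tau : ('V_P[tau] = (x / mu ^+ 3)%:E)%E.
Proof.
rewrite /variance unlock expectation_tau /=.
have := expectation_quadratic (moment_tau ^+ 2) (- (2 * moment_tau)) 0 1 0 0.
rewrite (_ : moment_tau ^+ 2 + _ = x / mu ^+ 3).
  by move=> <-; congr expectation; apply/funext => w; rewrite !fctE /=; ring.
by rewrite /moment_tau /moment_tau2; field; rewrite gt_eqF.
Qed.

Lemma variance_A : ('V_P[A] =
  (x * (4 * x ^+ 2 * mu ^+ 2 + 12 * mu * x + 15) / (12 * mu ^+ 5))%:E)%E.
Proof.
rewrite /variance unlock expectation_A /=.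
have := expectation_quadratic (moment_A ^+ 2) 0 (- (2 * moment_A)) 0 0 1.
rewrite (_ : moment_A ^+ 2 + _ =
    x * (4 * x ^+ 2 * mu ^+ 2 + 12 * mu * x + 15) / (12 * mu ^+ 5)).
  by move=> <-; congr expectation; apply/funext => w; rewrite !fctE /=; ring.
by rewrite /moment_A /moment_A2; field; rewrite gt_eqF.
Qed.

Lemma correlation_first_passage : correlation P tau A =
  Num.sqrt ((3 * x ^+ 2 * mu ^+ 2 + 12 * mu * x + 12) /
            (4 * x ^+ 2 * mu ^+ 2 + 12 * mu * x + 15)).
Proof.
have p0 : 0 < 4 * x ^+ 2 * mu ^+ 2 + 12 * mu * x + 15.
  by rewrite !addr_gt0// !mulr_gt0// exprn_gt0.
rewrite /correlation (E_ expectation_tauA) (E_ expectation_tau) (E_ expectation_A).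
rewrite variance_tau variance_A /=.
have cov : moment_tauA - moment_tau * moment_A = x * (x * mu + 2) / (2 * mu ^+ 4).
  by rewrite /moment_tauA /moment_tau /moment_A; field; rewrite gt_eqF.
rewrite cov.
have c0 : 0 <= x * (x * mu + 2) / (2 * mu ^+ 4).
  by rewrite divr_ge0 ?mulr_ge0 ?addr_ge0 ?mulr_ge0 ?exprn_ge0 ?ltW.
set v := x / mu ^+ 3 * _.
have v0 : 0 < v by rewrite mulr_gt0 ?divr_gt0 ?mulr_gt0 ?exprn_gt0.
(* The covariance is nonnegative, hence the root of its square; inside the root, 3 (x mu + 2)^2 is
   the numerator of the claim. *)
rewrite -[X in X / _ = _](ger0_norm c0) -sqrtr_sqr -[X in _ / X = _]mul1r.
rewrite mul1r -sqrtrV ?(ltW v0)// -sqrtrM ?sqr_ge0//; congr Num.sqrt.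
by rewrite /v; field; rewrite !gt_eqF.
Qed.

End correlation_first_passage.

Theorem mainTheorem3 (d : measure_display) (T : measurableType d)
    (R : realType) (P : probability T R) (B : R -> {RV P >-> R})
    (hB : standard_brownian_motion B) (x mu : R) (hx : 0 < x) (hmu : 0 < mu) :
  let X := drifted B mu x in
  let tau : T -> R := fun w => fine (first_passage_time X w) in
  let A : T -> R := first_passage_area X in
  let rho := correlation P tau A in
  rho = Num.sqrt ((3 * x ^+ 2 * mu ^+ 2 + 12 * mu * x + 12) /
                  (4 * x ^+ 2 * mu ^+ 2 + 12 * mu * x + 15))
  /\ 0 < rho.
Proof.
move=> X tau A rho.
have rhoE := correlation_first_passage hB hx hmu.
split; first exact: rhoE.
rewrite /rho rhoE sqrtr_gt0 divr_gt0// !addr_gt0// !mulr_gt0// exprn_gt0//.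
Qed.
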